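(* In the setting and under the regularity assumption described in the context, fix $x\in\mathcal X$ and write $\ell_k(z)=\ell_k(x,z)$, $\ell(z)=\ell(x,z)$. Then the worst-case expectation problem $\max_{\mathbb Q\in\mathcal P}\mathbb E_{z\sim\mathbb Q}[\ell(z)]$ is equivalent to (in particular has the same optimal value as) $$\max\Big\{\frac1N\sum_{i=1}^N V_i(b_i)\;:\; b\in\mathbb R_+^N,\ \frac1N\sum_{i=1}^N b_i\le\rho\Big\},$$ where for every $i\in[N]$ and $b_i\ge0$ $$V_i(b_i)=\max_{1\le k_1<k_2\le K}V_i^{(k_1,k_2)}(b_i),$$ and, for $1\le k_1<k_2\le K$, $$V_i^{(k_1,k_2)}(b_i)=\max\left\{\alpha_1\ell_{k_1}(\hat z_i+v_1)+\alpha_2\ell_{k_2}(\hat z_i+v_2)\;:\;\begin{array}{l}\alpha_j,\beta_j\in\mathbb R_+,\ v_j\in\mathbb R^m,\ \hat z_i+v_j\in\mathcal Z,\\ \alpha_j\,c(\hat z_i+v_j,\hat z_i)\le\beta_j,\ j\in\{1,2\},\\ \alpha_1+\alpha_2=1,\ \beta_1+\beta_2=b_i\end{array}\right\}.$$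
   Context: Notation: $[n]=\{1,\dots,n\}$; $\mathcal P(\mathcal Z)$ is the set of Borel probability measures on $\mathcal Z$. Setting. $\mathcal X\subseteq\mathbb R^n$, $\mathcal Z\subseteq\mathbb R^m$. A transportation cost $c:\mathcal Z\times\mathcal Z\to\mathbb R_+$ is lower semicontinuous, satisfies $c(z,z)=0$ for all $z$, and $c(\cdot,\hat z)$ is convex for every fixed $\hat z\in\mathcal Z$. The optimal transport discrepancy is $\mathrm{OT}_c(\mathbb P,\mathbb Q)=\min_{\gamma}\mathbb E_{(z,\hat z)\sim\gamma}[c(z,\hat z)]$ over couplings $\gamma$ of $\mathbb P$ and $\mathbb Q$. Given $\hat z_1,\dots,\hat z_N\in\mathcal Z$, let $\hat{\mathbb P}=\frac1N\sum_{i=1}^N\delta_{\hat z_i}$; given $\rho>0$, let $\mathcal P=\{\mathbb P\in\mathcal P(\mathcal Z):\mathrm{OT}_c(\mathbb P,\hat{\mathbb P})\le\rho\}$. Regularity assumption. (i) $\mathcal X$ is nonempty and convex; there exist $\mathbb Q_0\in\mathcal P$ and $x_0\in\mathcal X$ such that $x\mapsto\mathbb E_{z\sim\mathbb Q_0}[\ell(x,z)]$ is inf-compact on $\mathcal X$ (all sublevel sets $\{x\in\mathcal X:\mathbb E_{\mathbb Q_0}[\ell(x,z)]\le a\}$, $a\in\mathbb R$, are compact) and $\mathbb E_{z\sim\mathbb Q_0}[\ell(x_0,z)]>-\infty$; $\mathcal Z$ is nonempty, closed and convex. (ii) $\ell(x,z)=\max_{k\in[K]}\ell_k(x,z)$ with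 $K\ge2$, where each $\ell_k:\mathbb R^n\times\mathbb R^m\to\mathbb R$ is real-valued, convex in its first and concave in its second argument. (iii) There exist a norm $\|\cdot\|$ on $\mathbb R^m$ and $p\ge1$ with $c(z,\hat z)\ge\|z-\hat z\|^p$ for all $z,\hat z\in\mathcal Z$; moreover, if $p=1$, then for every $x\in\mathcal X$ there exist $g>0$, $\hat z_0\in\mathcal Z$ and $r\in[0,1)$ such that $\ell(x,z)\le g[1+\|z-\hat z_0\|^r]$ for all $z\in\mathcal Z$. *)

(* Defs.v *)
From HB Require Import structures.
From mathcomp Require Import all_boot all_order all_algebra.
From mathcomp Require Import all_classical all_reals all_analysis.

Set Implicit Arguments.
Unset Strict Implicit.
Unset Printing Implicit Defensive.

Import Order.TTheory GRing.Theory Num.Theory.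
Import numFieldNormedType.Exports.

Local Open Scope classical_set_scope.
Local Open Scope ring_scope.

Definition borel_rV (R : realType) (m : nat) :=
  g_sigma_algebraType (@open 'rV[R]_m).

Definition is_norm (R : realType) (m : nat) (nrm : 'rV[R]_m -> R) : Prop :=
  [/\ forall u v, nrm (u + v) <= nrm u + nrm v,
      forall (a : R) u, nrm (a *: u) = `|a| * nrm u
    & forall u, nrm u = 0 -> u = 0].

Definition is_maximizer (R : realType) (T : Type) (f : T -> \bar R)
    (S : set T) (t : T) : Prop :=
  S t /\ forall u, S u -> (f u <= f t)%E.

(* [c] is only meaningful on [Z `*` Z]; its values elsewhere are never used. *)
Definition transport_cost (R : realType) (m : nat) (Z : set 'rV[R]_m)
    (c : 'rV[R]_m -> 'rV[R]_m -> R) : Prop :=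
  [/\ forall z zh, Z z -> Z zh -> 0 <= c z zh,
      @lower_semicontinuous (subspace (Z `*` Z)) R
        (fun w => (c w.1 w.2)%:E),
      forall z, Z z -> c z z = 0
    & forall zh, Z zh -> convex_function Z (fun z => c z zh)].

Definition is_coupling (R : realType) (d : measure_display)
    (T : measurableType d) (P Q : set T -> \bar R)
    (gamma : probability (T * T)%type R) : Prop :=
  (forall A, measurable A -> pushforward gamma fst A = P A) /\
  (forall A, measurable A -> pushforward gamma snd A = Q A).

(* Measures on [Z] are measures on [R^m] of full mass on [Z], so every coupling
   of two of them is concentrated on [Z `*` Z]. *)
Definition OT (R : realType) (m : nat) (Z : set 'rV[R]_m)
    (c : 'rV[R]_m -> 'rV[R]_m -> R)
    (P Q : set (borel_rV R m) -> \bar R) : \bar R :=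
  ereal_inf [set (\int[gamma]_(w in Z `*` Z) (c w.1 w.2)%:E)%E
            | gamma in is_coupling P Q].

Definition empirical (R : realType) (m N : nat) (zh : 'I_N -> 'rV[R]_m)
    (A : set (borel_rV R m)) : \bar R :=
  ((N%:R^-1)%:E * \sum_(i < N) @dirac _ (borel_rV R m) (zh i) R A)%E.

Definition ambiguity_set (R : realType) (m N : nat) (Z : set 'rV[R]_m)
    (c : 'rV[R]_m -> 'rV[R]_m -> R) (zh : 'I_N -> 'rV[R]_m) (rho : R) :
    set (probability (borel_rV R m) R) :=
  [set Q | Q Z = 1%E /\ (OT Z c Q (empirical zh) <= rho%:E)%E].

(* The supremum of a finite, nonempty family, see [max_loss_max]. *)
Definition max_loss (R : realType) (T : Type) (K : nat)
    (l : 'I_K -> T -> R) (t : T) : R :=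
  sup (range (fun k => l k t)).

Lemma max_loss_max (R : realType) (T : Type) (K : nat) (l : 'I_K -> T -> R)
    (t : T) : (0 < K)%N ->
  (forall k, l k t <= max_loss l t) /\ exists k, max_loss l t = l k t.
Proof.
case: K l => // K l _.
pose k0 := [arg max_(k > ord0) l k t]%O.
have k0P k : l k t <= l k0 t.
  by rewrite /k0; case: arg_maxP => // i _ /(_ k isT).
have E : max_loss l t = l k0 t.
  apply/le_anti/andP; split.
    by apply: ge_sup; [exists (l k0 t), k0 | move=> _ [k _ <-]].
  by apply: ub_le_sup; [exists (l k0 t) => _ [k _ <-] | exists k0].
by split; [move=> k; rewrite E | exists k0].
Qed.

(* The decision variables of the problem defining V_i^(k1,k2). *)
Record plan (R : realType) (m : nat) := Plan {
  alpha1 : R; alpha2 : R;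
  beta1 : R; beta2 : R;
  v1 : 'rV[R]_m; v2 : 'rV[R]_m }.

Definition plan_feasible (R : realType) (m : nat) (Z : set 'rV[R]_m)
    (c : 'rV[R]_m -> 'rV[R]_m -> R) (z : 'rV[R]_m) (b : R) : set (plan R m) :=
  [set s | [/\ [/\ 0 <= alpha1 s, 0 <= alpha2 s, 0 <= beta1 s & 0 <= beta2 s],
               Z (z + v1 s) /\ Z (z + v2 s),
               alpha1 s * c (z + v1 s) z <= beta1 s /\
               alpha2 s * c (z + v2 s) z <= beta2 s,
               alpha1 s + alpha2 s = 1
             & beta1 s + beta2 s = b]].

Definition plan_value (R : realType) (m : nat) (l1 l2 : 'rV[R]_m -> R)
    (z : 'rV[R]_m) (s : plan R m) : R :=
  alpha1 s * l1 (z + v1 s) + alpha2 s * l2 (z + v2 s).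

Definition V_pair (R : realType) (m : nat) (Z : set 'rV[R]_m)
    (c : 'rV[R]_m -> 'rV[R]_m -> R) (l1 l2 : 'rV[R]_m -> R) (z : 'rV[R]_m)
    (b : R) : \bar R :=
  ereal_sup [set (plan_value l1 l2 z s)%:E | s in plan_feasible Z c z b].

Definition V_max (R : realType) (m K : nat) (Z : set 'rV[R]_m)
    (c : 'rV[R]_m -> 'rV[R]_m -> R) (l : 'I_K -> 'rV[R]_m -> R)
    (z : 'rV[R]_m) (b : R) : \bar R :=
  \big[maxe/-oo%E]_(k : 'I_K * 'I_K | (k.1 < k.2)%N)
    V_pair Z c (l k.1) (l k.2) z b.

Definition budget_set (R : realType) (N : nat) (rho : R) : set ('I_N -> R) :=
  [set b | (forall i, 0 <= b i) /\ N%:R^-1 * \sum_(i < N) b i <= rho].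

Definition budget_value (R : realType) (m K N : nat) (Z : set 'rV[R]_m)
    (c : 'rV[R]_m -> 'rV[R]_m -> R) (l : 'I_K -> 'rV[R]_m -> R)
    (zh : 'I_N -> 'rV[R]_m) (b : 'I_N -> R) : \bar R :=
  ((N%:R^-1)%:E * \sum_(i < N) V_max Z c l (zh i) (b i))%E.

(* The distribution 1/N sum_i (alpha1_i delta_(zh_i + v1_i)
   + alpha2_i delta_(zh_i + v2_i)) encoded by the plans [s i]. *)
Definition plan_measure (R : realType) (m N : nat) (zh : 'I_N -> 'rV[R]_m)
    (s : 'I_N -> plan R m) (A : set (borel_rV R m)) : \bar R :=
  ((N%:R^-1)%:E * \sum_(i < N)
     ((alpha1 (s i))%:E * @dirac _ (borel_rV R m) (zh i + v1 (s i))%R R A +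
      (alpha2 (s i))%:E * @dirac _ (borel_rV R m) (zh i + v2 (s i))%R R A))%E.

(* Main.v *)
Require Import Defs.
From HB Require Import structures.
From mathcomp Require Import all_boot all_order all_algebra.
From mathcomp Require Import all_classical all_reals all_analysis.
From mathcomp Require Import measurable_realfun ring lra.

Set Implicit Arguments.
Unset Strict Implicit.
Unset Printing Implicit Defensive.

Import Order.TTheory GRing.Theory Num.Theory.
Import numFieldNormedType.Exports.

Local Open Scope classical_set_scope.
Local Open Scope ring_scope.

(* At a single atom zh_i, the best value v_i(b) obtainable from discrete
   perturbations of cost at most b is attained: a loss piece l_k with cost budget b
   has an optimal value phi_k(b) that is concave, nondecreasing, continuous and
   sublinear, so its perspective alpha * phi_k(beta / alpha) extends continuously by
   0 to alpha = 0, and a two-piece problem maximises a continuous function on a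
   rectangle. v_i is concave because a mixture of two two-atom plans can be pruned
   to two atoms by simplex pivots, and two atoms with the same piece are merged.

   Hence the budget problem is concave and has a Lagrange multiplier lam >= 0.
   Testing it with b_i = c(z_i, zh_i) gives l(z) <= sigma(zh_i) + lam c(z, zh_i) on Z,
   where the mean of sigma(zh_i) is at most the optimal value minus lam rho.
   Integrating this inequality against a coupling bounds every worst-case
   expectation by the optimal budget value, and the discrete distribution of an
   optimal plan attains it. *)

(** * Concave functions on R^m *)

Definition concave (R : realType) (V : lmodType R) (f : V -> R) :=
  forall (t : R) x y, 0 <= t <= 1 ->
    t * f x + (1 - t) * f y <= f (t *: x + (1 - t) *: y).

Lemma i01_ex (R : realType) (t : R) : 0 <= t <= 1 ->
  exists u : {i01 R}, u%:num = t.
Proof.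
move=> /andP[t0 t1].
suff h : Itv.spec (Itv.num_sem (R := R)) (Itv.Real `[0%Z, 1%Z]) t by exists (Itv.mk h).
by rewrite /= /Itv.num_sem /= in_itv /= ?t0 ?t1 ?num_real.
Qed.

Lemma convex_functionP (R : realType) (V : lmodType R) (D : set V) (f : V -> R)
    (t : R) x y :
  convex_function D f -> 0 <= t <= 1 -> D x -> D y ->
  f (t *: x + (1 - t) *: y) <= t * f x + (1 - t) * f y.
Proof.
move=> cf /i01_ex[u <-] Dx Dy.
by have := cf u x y; rewrite !inE => /(_ Dx Dy).
Qed.

Lemma convex_setP (R : realType) (V : lmodType R) (D : set V) (t : R) x y :
  convex_set D -> 0 <= t <= 1 -> D x -> D y -> D (t *: x + (1 - t) *: y).
Proof.
move=> cD /i01_ex[u <-] Dx Dy.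
by have := cD x y u; rewrite !inE => /(_ Dx Dy).
Qed.

Lemma convex_function_concave (R : realType) (V : lmodType R) (f : V -> R) :
  convex_function [set: V] (fun z => - f z) -> concave f.
Proof.
move=> cf t x y t01; have := convex_functionP cf t01 (I : setT x) (I : setT y).
by rewrite !mulrN -opprD lerN2.
Qed.

Lemma norm_coord_le (R : realType) (m : nat) (v : 'rV[R]_m) i : `|v ord0 i| <= `|v|.
Proof.
by rewrite [leRHS]/Num.norm /= mx_normrE; apply/bigmax_geP; right; exists (ord0, i).
Qed.

Section concave_continuity.
Context {R : realType} {m : nat}.
Implicit Types (f : 'rV[R]_m -> R) (z v : 'rV[R]_m).

(** The point z + v_i e_i + s is the midpoint of z + 2 v_i e_i and z + 2 s, so induction over the
    coordinates works if the radius [T] doubles at each step. Along one axis, concavity bounds [f]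
    below by its values at the ends of a segment. *)
Lemma concave_bounded_below_span f z (r : seq 'I_m) (T : R) : concave f ->
  0 <= T -> exists C, forall v, (forall i, `|v ord0 i| <= T) ->
    C <= f (z + \sum_(i <- r) v ord0 i *: delta_mx 0 i).
Proof.
move=> cf; elim: r T => [|i r IH] T T0.
  by exists (f z) => v _; rewrite big_nil addr0.
have [C hC] := IH (2 * T) (mulr_ge0 (ler0n _ 2) T0).
pose e : 'rV[R]_m := (2 * T) *: delta_mx 0 i.
pose L := Num.min (f (z + e)) (f (z - e)).
exists (2^-1 * L + 2^-1 * C) => v hv; rewrite big_cons.
set s := \sum_(j <- r) _.
have hs : C <= f (z + 2 *: s).
  rewrite /s scaler_sumr.
  rewrite [X in z + X](eq_bigr (fun j => (2 *: v) ord0 j *: 'e_j)); last first.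
    by move=> j _; rewrite scalerA mxE.
  by apply: hC => j; rewrite mxE normrM ger0_norm // ler_pM2l.
have he : L <= f (z + 2 *: (v ord0 i *: delta_mx 0 i)).
  have [T0'|T1] := eqVneq T 0.
    have := hv i; rewrite T0' normr_le0 => /eqP ->.
    by rewrite scale0r scaler0 addr0 /L /e T0' mulr0 scale0r addr0 ge_min lexx.
  have Tp : 0 < T by rewrite lt_def T1.
  pose t := (v ord0 i / T + 1) / 2.
  have t01 : 0 <= t <= 1.
    move: (hv i); rewrite ler_norml => /andP[h1 h2].
    have : -1 <= v ord0 i / T by rewrite ler_pdivlMr // mulN1r.
    have : v ord0 i / T <= 1 by rewrite ler_pdivrMr // mul1r.
    by rewrite /t; lra.
  have := cf t (z + e) (z - e) t01.
  rewrite (_ : t *: _ + _ = z + 2 *: (v ord0 i *: delta_mx 0 i)); last first.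
    rewrite !scalerDr addrACA -scalerDl.
    rewrite (_ : t + (1 - t) = 1) ?scale1r; last by ring.
    congr (_ + _); rewrite scalerN -scalerBl /e !scalerA; congr (_ *: _).
    by rewrite /t; field.
  have h1 : L <= f (z + e) by rewrite /L ge_min lexx.
  have h2 : L <= f (z - e) by rewrite /L ge_min lexx orbT.
  apply: le_trans.
  by move: t01 => /andP[]; nra.
have h01 : 0 <= (2^-1 : R) <= 1 by lra.
have := cf 2^-1 (z + 2 *: (v ord0 i *: delta_mx 0 i)) (z + 2 *: s) h01.
rewrite (_ : 1 - 2^-1 = 2^-1 :> R); last by field.
rewrite (_ : 2^-1 *: (z + _) + _ = z + (v ord0 i *: delta_mx 0 i + s)); last first.
  rewrite !scalerDr addrACA -scalerDl 2!(scalerA 2^-1 2) mulVf ?pnatr_eq0 //.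
  rewrite !scale1r (_ : 2^-1 + 2^-1 = 1 :> R) ?scale1r //.
  by field.
by apply: le_trans; lra.
Qed.

Lemma concave_lower_ball f z : concave f ->
  exists2 C, 0 <= C & forall v, `|v| <= 1 -> f z - f (z + v) <= C.
Proof.
move=> cf.
have [C hC] := concave_bounded_below_span z (index_enum 'I_m) cf ler01.
exists (Num.max 0 (f z - C)) => [|v v1]; first by rewrite le_max lexx.
rewrite le_max; apply/orP; right; rewrite lerB // [v]row_sum_delta; apply: hC => i.
exact: le_trans (norm_coord_le _ _) _.
Qed.

(** For v <> 0 the point z lies between z + v and z - v / |v|, so the lower bound on the unit ball
    limits the growth of [f] at any distance. The second bound interpolates between z and z + v /
    |v|. *)
Lemma concave_upper_linear f z : concave f ->
  exists2 C, 0 <= C & (forall v, f (z + v) - f z <= C * `|v|) /\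
    (forall v, `|v| <= 1 -> f z - f (z + v) <= C * `|v|).
Proof.
move=> cf; have [C C0 hC] := concave_lower_ball z cf; exists C => //.
have nrm1 v : v != 0 -> `| `|v|^-1 *: v| <= 1.
  move=> v0; rewrite normrZ ger0_norm ?invr_ge0 ?normr_ge0 //.
  by rewrite mulVf ?normr_eq0.
split=> v.
  have [->|v0] := eqVneq v 0; first by rewrite addr0 subrr normr0 mulr0.
  have vp : 0 < `|v| by rewrite normr_gt0.
  have vn : `|v| != 0 by rewrite normr_eq0.
  have v1 : 0 < 1 + `|v| by rewrite ltr_wpDr.
  have v1n : 1 + `|v| != 0 by rewrite gt_eqF.
  have := hC (- (`|v|^-1 *: v)); rewrite normrN => /(_ (nrm1 _ v0)) h.
  pose t := (1 + `|v|)^-1.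
  have t01 : 0 <= t <= 1.
    by rewrite invr_ge0 ltW //= invf_le1 // lerDl.
  have := cf t (z + v) (z - `|v|^-1 *: v) t01.
  rewrite (_ : t *: _ + _ = z); last first.
    rewrite !scalerDr addrACA -scalerDl scalerN scalerA -scalerBl.
    rewrite (_ : t + (1 - t) = 1); last by ring.
    rewrite (_ : t - _ = 0) ?scale0r ?addr0 ?scale1r //.
    by rewrite /t; field; rewrite vn v1n.
  have tE : 1 - t = `|v| * t by rewrite /t; field.
  rewrite tE -(ler_pM2l v1).
  rewrite (_ : _ * (t * _ + _) = f (z + v) + `|v| * f (z - `|v|^-1 *: v)); last first.
    by rewrite /t; field.
  nra.
move=> v1.
have [->|v0] := eqVneq v 0; first by rewrite addr0 subrr normr0 mulr0.
have vn : `|v| != 0 by rewrite normr_eq0.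
have h := hC _ (nrm1 _ v0).
have t01 : 0 <= `|v| <= 1 by rewrite normr_ge0.
have := cf `|v| (z + `|v|^-1 *: v) z t01.
rewrite scalerDr scalerA mulfV // scale1r addrAC -scalerDl.
rewrite (_ : `|v| + (1 - `|v|) = 1) ?scale1r; last by ring.
move: t01 => /andP[]; nra.
Qed.

Lemma concave_continuous f : concave f -> continuous f.
Proof.
move=> cf z; have [C C0 [hu hl]] := concave_upper_linear z cf.
apply/(@cvgrPdist_le _ _ _ (nbhs z)) => e e0.
have d0 : 0 < Num.min 1 (e / (C + 1)).
  by rewrite lt_min ltr01 divr_gt0 // ltr_wpDl.
near=> w.
have : `|z - w| <= Num.min 1 (e / (C + 1)).
  by near: w; apply: cvgr_dist_le => //; exact: cvg_id.
rewrite distrC le_min => /andP[w1 w2].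
have := hu (w - z); have := hl _ w1; rewrite [z + _]addrC subrK => h1 h2.
have : C * `|w - z| <= e.
  apply: (@le_trans _ _ ((C + 1) * `|w - z|)).
    by rewrite ler_wpM2r // lerDl.
  by rewrite mulrC -ler_pdivlMr // ltr_wpDl.
by rewrite ler_norml; lra.
Unshelve. all: by end_near. Qed.
End concave_continuity.

(** [nrm] is continuous because its opposite is concave, so it has a positive minimum on the unit
    sphere of the sup norm. *)
Lemma norm_equiv (R : realType) (m : nat) (nrm : 'rV[R]_m -> R) : is_norm nrm ->
  exists2 k, 0 < k & forall v, `|v| <= k * nrm v.
Proof.
move=> [tri hom sep].
have n0 : nrm 0 = 0 by rewrite -(scale0r 0) hom normr0 mul0r.
have nge v : 0 <= nrm v.
  have := tri v (- v); rewrite subrr n0 -scaleN1r hom normrN1 mul1r; lra.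
have cN : concave (fun v => - nrm v).
  move=> t x y /andP[t0 t1]; rewrite !mulrN -opprD lerN2.
  by apply: le_trans (tri _ _) _; rewrite !hom !ger0_norm // subr_ge0.
have cn : continuous nrm.
  have -> : nrm = (fun v => - (- nrm v)) by apply/funext => v; rewrite opprK.
  by move=> v; exact: (cvgN (concave_continuous cN (x := v))).
pose S := [set v : 'rV[R]_m | `|v| = 1].
(* The sphere is empty when [m = 0]; every vector is then 0. *)
have [S0|/set0P/negP] := pselect (S !=set0); last first.
  move=> /negPn/eqP SE; exists 1 => // v.
  have [->|v0] := eqVneq v 0; first by rewrite normr0 n0 mulr0.
  have : S (`|v|^-1 *: v).
    by rewrite /S /= normrZ ger0_norm ?invr_ge0 ?normr_ge0 // mulVf ?normr_eq0.
  by rewrite SE.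
have cS : compact S.
  apply: bounded_closed_compact.
    exists 1; split => // M M1 v /= ->; exact: ltW.
  have -> : S = Num.norm @^-1` [set 1] by [].
  by apply: preimage_closed => [v _|]; [exact: norm_continuous|exact: closed_eq].
have [v0] := EVT_min_rV S0 cS (continuous_subspaceT cn).
rewrite inE => v01 hv0.
have v0n : nrm v0 != 0.
  apply/eqP => /sep v00; move: v01; rewrite /S /= v00 normr0 => /eqP.
  by rewrite eq_sym oner_eq0.
have v0p : 0 < nrm v0 by rewrite lt_def v0n nge.
exists (nrm v0)^-1; first by rewrite invr_gt0.
move=> v; have [->|vn] := eqVneq v 0; first by rewrite normr0 n0 mulr0.
have vp : 0 < `|v| by rewrite normr_gt0.
rewrite mulrC ler_pdivlMr //.
have := hv0 (`|v|^-1 *: v); rewrite inE => h.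
have : nrm v0 <= nrm (`|v|^-1 *: v).
  by apply: h; rewrite /S /= normrZ ger0_norm ?invr_ge0 ?normr_ge0 // mulVf ?normr_eq0.
rewrite hom ger0_norm ?invr_ge0 ?normr_ge0 // mulrC ler_pdivlMr // mulrC //.
Qed.

(** * Value functions of one real budget *)

(** The third clause is right-continuity at 0, stated through affine majorants: the two are
    equivalent for a function that is concave and nondecreasing on the half-line. *)
Definition value_function (R : realType) (g : R -> R) :=
  [/\ forall t x y, 0 <= t <= 1 -> 0 <= x -> 0 <= y ->
        t * g x + (1 - t) * g y <= g (t * x + (1 - t) * y),
      forall x y, 0 <= x -> x <= y -> g x <= g y
    & forall e, 0 < e -> exists2 M, 0 <= M &
        forall b, 0 <= b -> g b <= g 0 + e + M * b].

(** Concavity between 0 and b + h bounds both g b and g h from below, with weights b / (b + h) and h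
    / (b + h) that add up to 1. Increments are thus largest at 0. *)
Lemma value_function_increment (R : realType) (g : R -> R) b h :
  value_function g -> 0 <= b -> 0 <= h -> g (b + h) - g b <= g h - g 0.
Proof.
move=> [gc _ _] b0 h0.
have [/eqP|bh] := eqVneq (b + h) 0.
  by rewrite paddr_eq0 // => /andP[/eqP -> /eqP ->]; rewrite addr0.
have bhp : 0 < b + h by rewrite lt_def bh addr_ge0.
have t01 : 0 <= b / (b + h) <= 1.
  by rewrite divr_ge0 ?addr_ge0 //= ler_pdivrMr // mul1r lerDl.
have s01 : 0 <= h / (b + h) <= 1.
  by rewrite divr_ge0 ?addr_ge0 //= ler_pdivrMr // mul1r lerDr.
have := gc _ (b + h) 0 t01 (addr_ge0 b0 h0) (lexx 0).
have := gc _ (b + h) 0 s01 (addr_ge0 b0 h0) (lexx 0).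
rewrite !mulr0 !addr0 !divfK //.
have -> : h / (b + h) = 1 - b / (b + h) by field.
lra.
Qed.

(** Increments are largest at 0, so the affine majorant at 0 controls all of them. Clamping the
    argument at 0 gives a function continuous on the whole line. *)
Lemma value_function_continuous (R : realType) (g : R -> R) :
  value_function g -> continuous (fun b : R => g (Num.max 0 b)).
Proof.
move=> vg b0; apply/(@cvgrPdist_le _ _ _ (nbhs b0)) => e e0.
have [gc gm gM] := vg; have [M M0 hM] := gM _ (divr_gt0 e0 (ltr0n _ 2)).
have key x y : x <= y -> y - x <= e / 2 / (M + 1) ->
    `|g (Num.max 0 x) - g (Num.max 0 y)| <= e.
  move=> xy yx.
  have x0 : 0 <= Num.max 0 x by rewrite le_max lexx.
  have xy' : Num.max 0 x <= Num.max 0 y.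
    by rewrite ge_max !le_max lexx xy orbT.
  have d0 : 0 <= Num.max 0 y - Num.max 0 x by rewrite subr_ge0.
  have d1 : Num.max 0 y - Num.max 0 x <= y - x.
    by rewrite !maxEle; case: ifP; case: ifP; lra.
  have := value_function_increment vg x0 d0; rewrite [Num.max 0 x + _]addrC subrK.
  have := hM _ d0; have := gm _ _ x0 xy'.
  have : (Num.max 0 y - Num.max 0 x) * (M + 1) <= e / 2.
    by rewrite -ler_pdivlMr ?ltr_wpDl //; exact: le_trans yx.
  rewrite ler_norml; nra.
near=> b.
have : `|b0 - b| <= e / 2 / (M + 1).
  near: b; apply: (@cvgr_dist_le _ _ _ (nbhs b0) _ id) => //.
  by rewrite !divr_gt0 // ltr_wpDl.
have [bb|/ltW bb] := leP b0 b.
  rewrite distrC ger0_norm ?subr_ge0 //; exact: key.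
rewrite ger0_norm ?subr_ge0 // distrC; exact: key.
Unshelve. all: by end_near. Qed.

(* The perspective of [g], extended by its limit 0 to [w.1 <= 0]. *)
Definition perspective (R : realType) (g : R -> R) (w : R * R) : R :=
  if 0 < w.1 then w.1 * g (Num.max 0 (w.2 / w.1)) else 0.

(** Only w.1 = 0 is delicate: for small w.1 > 0 the value lies between w.1 * g 0, by monotonicity,
    and w.1 * C + e' * max(0, w.2), by sublinearity, with e' as small as desired. *)
Lemma perspective_continuous (R : realType) (g : R -> R) :
  value_function g ->
  (forall e, 0 < e -> exists C, forall b, 0 <= b -> g b <= C + e * b) ->
  continuous (perspective g).
Proof.
move=> vg hg w0.
have cf : {for w0, continuous (fun w : R * R => w.1)} by exact: cvg_fst.
have cs : {for w0, continuous (fun w : R * R => w.2)} by exact: cvg_snd.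
have [w0p|w0n|w00] := ltgtP 0 w0.1.
- have E : \forall w \near w0, w.1 * g (Num.max 0 (w.2 / w.1)) = perspective g w.
    near=> w; rewrite /perspective ifT //; near: w.
    exact: (cvgr_gt w0.1).
  apply: (cvg_trans (near_eq_cvg E)).
  rewrite /perspective w0p.
  apply: cvgM => //.
  apply: (@continuous_comp _ _ _ (fun w : R * R => w.2 / w.1)
    (fun b => g (Num.max 0 b))); last exact: value_function_continuous.
  by apply: cvgM => //; apply: cvgV => //; rewrite gt_eqF.
- have E : \forall w \near w0, 0 = perspective g w.
    near=> w; rewrite /perspective ifF //; apply/negbTE; rewrite -leNgt ltW //.
    near: w; exact: (cvgr_lt w0.1).
  apply: (cvg_trans (near_eq_cvg E)).
  rewrite /perspective ltNge (ltW w0n) /=; exact: cvg_cst.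
rewrite /continuous_at {2}/perspective -w00 ltxx.
apply/(@cvgrPdist_le _ _ _ (nbhs w0)) => e e0.
pose B := `|w0.2| + 1.
have B0 : 0 < B by rewrite ltr_wpDl.
have [C hC] := hg _ (divr_gt0 (divr_gt0 e0 (ltr0n _ 2)) B0).
pose D := `|C| + `|g 0| + 1.
have D0 : 0 < D by rewrite ltr_wpDl // addr_ge0.
near=> w; rewrite sub0r normrN /perspective; case: ifP => w1; last first.
  by rewrite normr0 ltW.
have w1D : w.1 * D <= e / 2.
  rewrite -ler_pdivlMr //; near: w.
  by apply: (cvgr_le w0.1) => //; rewrite -w00 !divr_gt0.
have w2B : w.2 <= B.
  by near: w; apply: (cvgr_le w0.2) => //; rewrite /B ltr_pwDr // ler_norm.
set b := Num.max 0 _.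
have b0 : 0 <= b by rewrite le_max lexx.
have bB : w.1 * b <= B.
  rewrite /b maxEle; case: ifP => _; last by rewrite mulr0 ltW.
  by rewrite mulrC divfK // gt_eqF.
have [_ gm _] := vg.
have h1 : w.1 * (C + e / 2 / B * b) <= e.
  have -> : w.1 * (C + e / 2 / B * b) = w.1 * C + (w.1 * b) / B * (e / 2).
    by field; rewrite gt_eqF.
  have : (w.1 * b) / B <= 1 by rewrite ler_pdivrMr // mul1r.
  have : w.1 * C <= w.1 * D.
    rewrite ler_pM2l // /D; have := ler_norm C; have := normr_ge0 (g 0); lra.
  nra.
have h2 : - e <= w.1 * g 0.
  have : w.1 * - g 0 <= w.1 * D.
    rewrite ler_pM2l // /D; have := ler_norm (- g 0); rewrite normrN.
    have := normr_ge0 C; lra.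
  lra.
rewrite ler_norml; apply/andP; split.
  by apply: (le_trans h2); rewrite ler_pM2l //; exact: gm.
by apply: le_trans h1; rewrite ler_pM2l //; exact: hC.
Unshelve. all: by end_near. Qed.

(** * Perturbing a single atom *)

(** The threshold [T] solves T ^ (r - 1) = e: below it u ^ r is at most T ^ r, above it u ^ r = u ^
    (r - 1) * u is at most e * u. *)
Lemma powR_sublinear (R : realType) (r e : R) : 0 <= r < 1 -> 0 < e ->
  exists C, forall u, 0 <= u -> u `^ r <= C + e * u.
Proof.
move=> /andP[r0 r1] e0; pose T := e `^ (r - 1)^-1.
have T0 : 0 < T by exact: powR_gt0.
have r1' : r - 1 != 0 by rewrite subr_eq0 lt_eqF.
have TE : T `^ (r - 1) = e by rewrite /T -powRrM mulVf // powRr1 // ltW.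
exists (T `^ r) => u u0; have [uT|/ltW Tu] := leP u T.
  apply: (@le_trans _ _ (T `^ r)); last by rewrite lerDl mulr_ge0 // ltW.
  by apply: ge0_ler_powR => //; rewrite nnegrE // ltW.
have up : 0 < u by exact: lt_le_trans Tu.
apply: (@le_trans _ _ (e * u)); last by rewrite lerDr powR_ge0.
have -> : u `^ r = u `^ (r - 1) * u.
  by rewrite -[X in _ * X](powRr1 u0) -powRD ?subrK // (gt_eqF up) implybT.
rewrite ler_pM2r // -TE -(opprB 1 r) !powRN lef_pV2 ?posrE ?powR_gt0 //.
by apply: ge0_ler_powR => //; rewrite ?nnegrE ?subr_ge0 ltW.
Qed.

(** Either u <= e, or u = u ^ (1 - p) * u ^ p with u ^ (1 - p) <= e ^ (1 - p). *)
Lemma linear_le_powR (R : realType) (p e : R) : 1 <= p -> 0 < e ->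
  exists2 M, 0 <= M & forall u, 0 <= u -> u <= e + M * u `^ p.
Proof.
move=> p1 e0; exists (e `^ (1 - p)) => [|u u0]; first exact: powR_ge0.
have [ue|/ltW eu] := leP u e.
  by apply: (le_trans ue); rewrite lerDl mulr_ge0 // powR_ge0.
have up : 0 < u by exact: lt_le_trans eu.
apply: (@le_trans _ _ (e `^ (1 - p) * u `^ p)); last by rewrite lerDr ltW.
have {1}-> : u = u `^ (1 - p) * u `^ p.
  by rewrite -powRD ?subrK ?powRr1 // (gt_eqF up) implybT.
rewrite ler_pM2r ?powR_gt0 // -(opprB p 1) !powRN lef_pV2 ?posrE ?powR_gt0 //.
by apply: ge0_ler_powR => //; rewrite ?nnegrE ?subr_ge0 // ltW.
Qed.

(* What the theorem uses of the cost [k := c ^~ zh] of moving mass from the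
   single atom [zh]. *)
Record site_cost (R : realType) (m : nat) (Z : set 'rV[R]_m) (zh : 'rV[R]_m)
    (k : 'rV[R]_m -> R) : Prop := SiteCost {
  site_closed : closed Z;
  site_in : Z zh;
  site_convex : forall t x y, 0 <= t <= 1 -> Z x -> Z y ->
    Z (t *: x + (1 - t) *: y) /\
    k (t *: x + (1 - t) *: y) <= t * k x + (1 - t) * k y;
  site_ge0 : forall z, Z z -> 0 <= k z;
  site_zh : k zh = 0;
  site_lsc : forall z a, Z z -> a < k z ->
    \forall y \near z, Z y -> a < k y;
  site_growth : forall e, 0 < e -> exists2 M, 0 <= M &
    forall z, Z z -> `|z - zh| <= e + M * k z }.

(** Sublinearity is relative to the cost: mass sent to infinity with vanishing weight and bounded
    total cost gains nothing in the limit, which is why maxima are attained. *)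
Record site_loss (R : realType) (m : nat) (Z : set 'rV[R]_m)
    (k f : 'rV[R]_m -> R) : Prop := SiteLoss {
  loss_concave : concave f;
  loss_sublinear : forall e, 0 < e ->
    exists C, forall z, Z z -> f z <= C + e * k z }.

Section site.
Context {R : realType} {m : nat} {Z : set 'rV[R]_m} {zh : 'rV[R]_m}
  {k : 'rV[R]_m -> R}.
Hypothesis kS : site_cost Z zh k.
Implicit Types f : 'rV[R]_m -> R.

Lemma site_sublevel_closed b : closed [set z | Z z /\ k z <= b].
Proof.
rewrite -[X in closed X]setCK; apply: open_closedC; rewrite openE => z /= nz.
have [Zz|nZz] := pselect (Z z).
  have bk : b < k z by rewrite ltNge; apply/negP => h; apply: nz.
  have := site_lsc kS Zz bk; apply: filterS => y yh [Zy].
  by rewrite leNgt yh.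
have /closed_openC := site_closed kS; rewrite openE => /(_ z nZz).
by apply: filterS => y nZy [].
Qed.

Lemma site_sublevel_compact b : compact [set z | Z z /\ k z <= b].
Proof.
apply: bounded_closed_compact; last exact: site_sublevel_closed.
have [M M0 hM] := site_growth kS ltr01.
exists (`|zh| + 1 + M * b); split=> [|B hB z /= [Zz kz]]; first exact: num_real.
have := ler_normD (z - zh) zh; rewrite subrK.
have := hM z Zz; have := ler_wpM2l M0 kz; move: hB; lra.
Qed.

Lemma loss_max f b : concave f -> 0 <= b ->
  exists z, [/\ Z z, k z <= b & forall y, Z y -> k y <= b -> f y <= f z].
Proof.
move=> cf b0.
have ne : [set z | Z z /\ k z <= b] !=set0.
  by exists zh; split; [exact: site_in kS|rewrite (site_zh kS)].
have [z] := EVT_max_rV ne (@site_sublevel_compact b)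
  (continuous_subspaceT (concave_continuous cf)).
rewrite inE => -[Zz kz] zM; exists z; split => // y Zy ky.
by apply: zM; rewrite inE.
Qed.

(** Concavity bounds f z - f zh linearly in the distance, and the growth of the cost turns distance
    into cost up to a small constant. This yields right-continuity of the value functions at 0. *)
Lemma loss_growth_zh f e : concave f -> 0 < e -> exists2 M, 0 <= M &
  forall z, Z z -> f z <= f zh + e + M * k z.
Proof.
move=> cf e0; have [C C0 [hC _]] := concave_upper_linear zh cf.
have C1 : 0 < C + 1 by rewrite ltr_wpDl.
have [M M0 hM] := site_growth kS (divr_gt0 e0 C1).
exists (C * M) => [|z Zz]; first exact: mulr_ge0.
have := hC (z - zh); rewrite [zh + _]addrC subrK => h.
have h1 : C * `|z - zh| <= C * (e / (C + 1) + M * k z) by rewrite ler_wpM2l // hM.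
have h2 : C * (e / (C + 1)) <= e.
  by rewrite mulrCA ger_pMr // ler_pdivrMr // mul1r lerDl.
by move: h1; rewrite mulrDr mulrA; lra.
Qed.

(** [phi b] is the maximum of [f] over a compact sublevel set of the cost; convexity of the cost
    makes [phi] concave. *)
Lemma loss_value_function f : site_loss Z k f -> exists phi : R -> R,
  [/\ value_function phi,
      forall e, 0 < e -> exists C, forall b, 0 <= b -> phi b <= C + e * b,
      forall b, 0 <= b -> exists z, [/\ Z z, k z <= b & f z = phi b]
    & forall b z, Z z -> k z <= b -> f z <= phi b].
Proof.
move=> [cf sf].
have /choice[zb hzb] : forall b, exists z, 0 <= b ->
    [/\ Z z, k z <= b & forall y, Z y -> k y <= b -> f y <= f z].
  move=> b; have [b0|] := pselect (0 <= b); last by exists zh.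
  by have [z hz] := loss_max cf b0; exists z.
have zle b z : Z z -> k z <= b -> f z <= f (zb b).
  move=> Zz kz; have b0 : 0 <= b by apply: le_trans kz; exact: (site_ge0 kS).
  by have [_ _] := hzb b b0; apply.
exists (fun b => f (zb b)); split.
- split.
  + move=> t x y t01 x0 y0.
    have [Zx kx _] := hzb _ x0; have [Zy ky _] := hzb _ y0.
    apply: le_trans (cf _ _ _ t01) _.
    have [Zc kc] := site_convex kS t01 Zx Zy.
    apply: zle => //; apply: (le_trans kc).
    by move: t01 => /andP[t0 t1]; apply: lerD; apply: ler_wpM2l; rewrite ?subr_ge0.
  + move=> x y x0 xy; have [Zx kx _] := hzb _ x0.
    by apply: zle => //; exact: le_trans xy.
  + move=> e e0; have [M M0 hM] := loss_growth_zh cf e0.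
    exists M => // b b0; have [Zb kb _] := hzb _ b0.
    apply: (le_trans (hM _ Zb)); rewrite !lerD ?ler_wpM2l //.
    by apply: zle; [exact: (site_in kS)|rewrite (site_zh kS)].
- move=> e e0; have [C hC] := sf _ e0; exists C => b b0.
  have [Zb kb _] := hzb _ b0; apply: (le_trans (hC _ Zb)).
  by rewrite lerD2l ler_pM2l.
- by move=> b b0; have [Zb kb _] := hzb _ b0; exists (zb b).
- exact: zle.
Qed.

(** With the weight and the cost share of the first atom fixed, the best value is a sum of two
    perspectives, continuous on the rectangle [0, 1] x [0, b]. *)
Lemma pair_max f1 f2 b : site_loss Z k f1 -> site_loss Z k f2 -> 0 <= b ->
  exists a1 a2 z1 z2, [/\ [/\ 0 <= a1, 0 <= a2 & a1 + a2 = 1],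
    [/\ Z z1, Z z2 & a1 * k z1 + a2 * k z2 <= b] &
    forall b1 b2 y1 y2, 0 <= b1 -> 0 <= b2 -> b1 + b2 = 1 -> Z y1 -> Z y2 ->
      b1 * k y1 + b2 * k y2 <= b ->
      b1 * f1 y1 + b2 * f2 y2 <= a1 * f1 z1 + a2 * f2 z2].
Proof.
move=> /loss_value_function[p1 [v1 s1 at1 le1]].
move=> /loss_value_function[p2 [v2 s2 at2 le2]] b0.
pose G (w : R * R) := perspective p1 w + perspective p2 (1 - w.1, b - w.2).
have cG : continuous G.
  move=> w; apply: cvgD; first exact: (perspective_continuous v1 s1).
  apply: (@continuous_comp _ _ _ (fun w : R * R => (1 - w.1, b - w.2))
    (perspective p2)); last exact: (perspective_continuous v2 s2).
  by apply: (@cvg_pair _ _ _ (nbhs w) (nbhs (1 - w.1)) (nbhs (b - w.2)));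
    apply: cvgB;
    [exact: cvg_cst|exact: cvg_fst|exact: cvg_cst|exact: cvg_snd].
have K0 : (`[0, 1]%classic `*` `[0, b]%classic : set (R * R)) !=set0.
  by exists (0, 0); split; rewrite /= in_itv /= lexx ?ler01 ?b0.
have [[a be]] := compact_EVT_max K0
  (compact_setX (@segment_compact R 0 1) (@segment_compact R 0 b))
  (continuous_subspaceT cG).
rewrite inE /= !in_itv /= => -[/andP[a0 a1] /andP[be0 beb]] hM.
(* At weight 0 the perspective vanishes and the atom may sit at [zh], so the value of the
   perspective is always realised. *)
have pick p f a' be' : (forall b, 0 <= b -> exists z, [/\ Z z, k z <= b & f z = p b]) ->
    0 <= a' -> 0 <= be' ->
    exists z, [/\ Z z, a' * k z <= be' & a' * f z = perspective p (a', be')].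
  move=> att a'0 be'0; rewrite /perspective /=; case: ltgtP a'0 => // [a'p|<-] _.
    have h : 0 <= Num.max 0 (be' / a') by rewrite le_max lexx.
    have [z [Zz kz fz]] := att _ h; exists z; split => //; last by rewrite fz.
    move: kz; rewrite max_r ?divr_ge0 ?(ltW a'p) // => kz.
    by rewrite mulrC -ler_pdivlMr.
  exists zh; split; [exact: (site_in kS)|by rewrite mul0r|by rewrite mul0r].
have up p f a' be' z : (forall b z, Z z -> k z <= b -> f z <= p b) ->
    0 <= a' -> Z z -> a' * k z <= be' -> a' * f z <= perspective p (a', be').
  move=> lep a'0 Zz; rewrite /perspective /=.
  case: ltgtP a'0 => // [a'p|<-] _ h; last by rewrite mul0r.
  rewrite ler_pM2l //; apply: lep => //.
  by rewrite le_max; apply/orP; right; rewrite ler_pdivlMr // mulrC.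
have a1' : 0 <= 1 - a by rewrite subr_ge0.
have be1' : 0 <= b - be by rewrite subr_ge0.
have [z1 [Z1 k1 e1]] := pick _ _ _ _ at1 a0 be0.
have [z2 [Z2 k2 e2]] := pick _ _ _ _ at2 a1' be1'.
exists a, (1 - a), z1, z2; split.
- by split=> //; rewrite addrC subrK.
- by split=> //; lra.
move=> b1 b2 y1 y2 b10 b20 b12 Zy1 Zy2 hb; rewrite e1 e2.
have k10 : 0 <= b1 * k y1 by rewrite mulr_ge0 // (site_ge0 kS).
have k20 : 0 <= b2 * k y2 by rewrite mulr_ge0 // (site_ge0 kS).
(* The competitor is tested with the share that its first atom really spends. *)
have := hM (b1, b1 * k y1); rewrite inE /= !in_itv /=.
have h1 : 0 <= b1 <= 1 by lra.
have h2 : 0 <= b1 * k y1 <= b by lra.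
move=> /(_ (conj h1 h2)); apply: le_trans; apply: lerD.
  exact: up.
rewrite /= (_ : 1 - b1 = b2); last by lra.
by apply: up => //; lra.
Qed.
End site.

(** * Two atoms suffice *)

(** Move from [a] along [d] until a first coordinate vanishes: this happens at the least ratio a_i /
    - d_i over the negative d_i. *)
Lemma ratio_test (R : realType) (I : finType) (a d : I -> R) i0 :
  (forall i, 0 <= a i) -> d i0 < 0 -> exists2 t, 0 <= t &
    (forall i, 0 <= a i + t * d i) /\ exists i, a i + t * d i = 0.
Proof.
move=> a0 di0.
case: (@arg_minP _ R I i0 (fun i => d i < 0) (fun i => a i / - d i) di0) => i di hi.
have r0 : 0 <= a i / - d i by rewrite divr_ge0 // oppr_ge0 ltW.
exists (a i / - d i) => //; split=> [j|]; last first.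
  by exists i; rewrite invrN mulrN mulNr divfK ?subrr // lt_eqF.
have [dj|dj] := leP 0 (d j); first by rewrite addr_ge0 // mulr_ge0.
by have := hi j dj; rewrite ler_pdivlMr ?oppr_gt0 // mulrN lerNl addrC -subr_ge0 opprK.
Qed.

(* One pivoting step of the simplex method: two linear constraints, so two of
   three atoms suffice. *)
Lemma three_to_two (R : realType) (T : Type) (c l : T -> R) (P : T -> Prop)
    (a1 a2 a3 : R) (x1 x2 x3 : T) :
  0 <= a1 -> 0 <= a2 -> 0 <= a3 -> P x1 -> P x2 -> P x3 ->
  exists b1 b2 y1 y2, [/\ [/\ 0 <= b1, 0 <= b2 & b1 + b2 = a1 + a2 + a3],
    P y1, P y2,
    b1 * c y1 + b2 * c y2 = a1 * c x1 + a2 * c x2 + a3 * c x3 &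
    a1 * l x1 + a2 * l x2 + a3 * l x3 <= b1 * l y1 + b2 * l y2].
Proof.
move=> h1 h2 h3 P1 P2 P3.
pose fin (b1 b2 b3 : R) := [/\ 0 <= b1, 0 <= b2 & 0 <= b3] /\
  [/\ b1 + b2 + b3 = a1 + a2 + a3,
    b1 * c x1 + b2 * c x2 + b3 * c x3 = a1 * c x1 + a2 * c x2 + a3 * c x3 &
    a1 * l x1 + a2 * l x2 + a3 * l x3 <= b1 * l x1 + b2 * l x2 + b3 * l x3].
suff [b1 [b2 [b3 [[[b10 b20 b30] [e1 e2 e3]] [z|z|z]]]]] : exists b1 b2 b3,
    fin b1 b2 b3 /\ [\/ b1 = 0, b2 = 0 | b3 = 0].
- by exists b2, b3, x2, x3; split => //; [split=> //|..]; move: e1 e2 e3; rewrite z; lra.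
- by exists b1, b3, x1, x3; split => //; [split=> //|..]; move: e1 e2 e3; rewrite z; lra.
- by exists b1, b2, x1, x2; split => //; [split=> //|..]; move: e1 e2 e3; rewrite z; lra.
(* It suffices to find a direction that preserves mass and cost, does not lower the value and has a
   negative entry: the ratio test follows it until one atom loses its mass. *)
suff [d1 [d2 [d3 [dn0 ds dc dl]]]] : exists d1 d2 d3,
    [/\ [\/ d1 < 0, d2 < 0 | d3 < 0], d1 + d2 + d3 = 0,
      d1 * c x1 + d2 * c x2 + d3 * c x3 = 0 &
      0 <= d1 * l x1 + d2 * l x2 + d3 * l x3].
  pose a (i : 'I_3) := nth 0 [:: a1; a2; a3] i.
  pose d (i : 'I_3) := nth 0 [:: d1; d2; d3] i.
  have a0 i : 0 <= a i by case: i => -[|[|[|]]].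
  have [i0 di0] : exists i, d i < 0.
    case: dn0 => h; [by exists (@Ordinal 3 0 isT)|by exists (@Ordinal 3 1 isT)|].
    by exists (@Ordinal 3 2 isT).
  have [t t0 [ht [i hi]]] := ratio_test a0 di0.
  exists (a1 + t * d1), (a2 + t * d2), (a3 + t * d3); split.
    split; first by split; [exact: (ht (@Ordinal 3 0 isT))|
      exact: (ht (@Ordinal 3 1 isT))|exact: (ht (@Ordinal 3 2 isT))].
    split.
    - by rewrite -[RHS]addr0 -(mulr0 t) -ds; ring.
    - by rewrite -[RHS]addr0 -(mulr0 t) -dc; ring.
    - by have := mulr_ge0 t0 dl; lra.
  by move: hi; case: i => -[|[|[|]]] //= hi H;
    [constructor 1|constructor 2|constructor 3].
(* A nonzero direction of zero sum has a negative entry, and so has its opposite; one of the two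
   does not lower the value. *)
suff [d1 [d2 [d3 [dn0 ds dc]]]] : exists d1 d2 d3,
    [/\ ~ [/\ d1 = 0, d2 = 0 & d3 = 0], d1 + d2 + d3 = 0 &
      d1 * c x1 + d2 * c x2 + d3 * c x3 = 0].
  have neg e1 e2 e3 : ~ [/\ e1 = 0, e2 = 0 & e3 = 0] -> e1 + e2 + e3 = 0 ->
      [\/ e1 < 0, e2 < 0 | e3 < 0 :> R].
    move=> en es; have [?|e10] := ltP e1 0; first by constructor 1.
    have [?|e20] := ltP e2 0; first by constructor 2.
    have [?|e30] := ltP e3 0; first by constructor 3.
    by exfalso; apply: en; split; lra.
  have [dl|/ltW dl] := leP 0 (d1 * l x1 + d2 * l x2 + d3 * l x3).
    by exists d1, d2, d3; split=> //; exact: neg.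
  exists (- d1), (- d2), (- d3); split; [|lra|lra|lra].
  by apply: neg; [case=> *; apply: dn0; split; lra|lra].
(* If the three costs agree, any transfer of mass preserves the cost; otherwise the direction is the
   cross product of the cost vector with (1, 1, 1). *)
have [[h12 h23]|h] := pselect (c x1 = c x2 /\ c x2 = c x3).
  exists 1, (-1), 0; split; [by case=> /eqP; rewrite oner_eq0|by ring|].
  by rewrite h12; ring.
exists (c x2 - c x3), (c x3 - c x1), (c x1 - c x2); split; [|by ring|by ring].
by case=> *; apply: h; split; lra.
Qed.

(** * The optimal two-atom value at one site *)

Section site_value.
Context {R : realType} {m K : nat} {Z : set 'rV[R]_m} {zh : 'rV[R]_m}
  {c : 'rV[R]_m -> 'rV[R]_m -> R} {f : 'I_K -> 'rV[R]_m -> R}.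
Hypotheses (K2 : (2 <= K)%N) (kS : site_cost Z zh (c ^~ zh))
  (fS : forall k, site_loss Z (c ^~ zh) (f k)).

(** Together with [plan_feasible_ex], this eliminates the shares beta: a plan amounts to two
    weighted atoms of total cost at most [b]. *)
Lemma plan_feasibleE b s : plan_feasible Z c zh b s ->
  let z1 := zh + v1 s in let z2 := zh + v2 s in
  [/\ [/\ 0 <= alpha1 s, 0 <= alpha2 s & alpha1 s + alpha2 s = 1], Z z1, Z z2 &
    alpha1 s * c z1 zh + alpha2 s * c z2 zh <= b].
Proof.
by move=> [[a1 a2 b1 b2] [Z1 Z2] [c1 c2] a12 b12] z1 z2; split => //; rewrite -b12 lerD.
Qed.

Lemma plan_feasible_ex a1 a2 z1 z2 b :
  0 <= a1 -> 0 <= a2 -> a1 + a2 = 1 -> Z z1 -> Z z2 ->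
  a1 * c z1 zh + a2 * c z2 zh <= b ->
  exists2 s, plan_feasible Z c zh b s &
    forall f1 f2, plan_value f1 f2 zh s = a1 * f1 z1 + a2 * f2 z2.
Proof.
move=> a10 a20 a12 Z1 Z2 hc.
have E z : zh + (z - zh) = z by rewrite addrC subrK.
have c1 : 0 <= a1 * c z1 zh by rewrite mulr_ge0 // (site_ge0 kS).
have c2 : 0 <= a2 * c z2 zh by rewrite mulr_ge0 // (site_ge0 kS).
exists (Plan a1 a2 (a1 * c z1 zh) (b - a1 * c z1 zh) (z1 - zh) (z2 - zh)).
  by rewrite /plan_feasible /= !E; do !split => //; lra.
by move=> f1 f2; rewrite /plan_value /= !E.
Qed.

Lemma plan_maximizer (k1 k2 : 'I_K) b : 0 <= b ->
  exists s, is_maximizer (fun s => (plan_value (f k1) (f k2) zh s)%:E)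
    (plan_feasible Z c zh b) s.
Proof.
move=> b0.
have [a1 [a2 [z1 [z2 [[a10 a20 a12] [Z1 Z2 hc] hM]]]]] :=
  pair_max kS (fS k1) (fS k2) b0.
have [s fs sv] := plan_feasible_ex a10 a20 a12 Z1 Z2 hc.
exists s; split => // u /plan_feasibleE[[u1 u2 u12] U1 U2 hu].
by rewrite lee_fin sv; exact: hM.
Qed.

Lemma best_plan b : 0 <= b -> exists (k1 k2 : 'I_K) s,
  [/\ (k1 < k2)%N, plan_feasible Z c zh b s &
   forall (j1 j2 : 'I_K) u, (j1 < j2)%N -> plan_feasible Z c zh b u ->
     plan_value (f j1) (f j2) zh u <= plan_value (f k1) (f k2) zh s].
Proof.
move=> b0.
have /choice[s hs] : forall q : 'I_K * 'I_K, exists s, is_maximizer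
    (fun s => (plan_value (f q.1) (f q.2) zh s)%:E) (plan_feasible Z c zh b) s.
  by move=> q; exact: plan_maximizer.
pose q0 : 'I_K * 'I_K := (Ordinal (ltnW K2), Ordinal K2).
have q0P : (q0.1 < q0.2)%N by [].
case: (@arg_maxP _ R _ q0 (fun q : 'I_K * 'I_K => (q.1 < q.2)%N)
  (fun q => plan_value (f q.1) (f q.2) zh (s q)) q0P) => -[k1 k2] /= k12 hk.
exists k1, k2, (s (k1, k2)); split => // [|j1 j2 u j12 fu].
  by have [] := hs (k1, k2).
apply: le_trans (hk (j1, j2) j12).
by have [_ /(_ u fu)] := hs (j1, j2); rewrite lee_fin.
Qed.

(** [v b] is the optimal two-atom value. The properties of [v] rest on [all2]: two atoms carrying
    any pieces, equal or not, are dominated by [v b]. *)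
Lemma site_value_function : exists v : R -> R,
  [/\ value_function v,
      forall b, 0 <= b -> V_max Z c f zh b = (v b)%:E,
      forall b, 0 <= b -> exists (k1 k2 : 'I_K) s, [/\ (k1 < k2)%N,
        plan_feasible Z c zh b s & plan_value (f k1) (f k2) zh s = v b]
    & forall z, Z z -> max_loss f z <= v (c z zh)].
Proof.
have /choice[v hv] : forall b, exists v, 0 <= b ->
    (exists (k1 k2 : 'I_K) s, [/\ (k1 < k2)%N, plan_feasible Z c zh b s &
      plan_value (f k1) (f k2) zh s = v]) /\
    (forall (j1 j2 : 'I_K) u, (j1 < j2)%N -> plan_feasible Z c zh b u ->
      plan_value (f j1) (f j2) zh u <= v).
  move=> b; have [b0|] := pselect (0 <= b); last by exists 0.
  have [k1 [k2 [s [k12 fs hs]]]] := best_plan b0.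
  by exists (plan_value (f k1) (f k2) zh s) => _; split => //; exists k1, k2, s.
have bge0 a1 a2 z1 z2 : 0 <= a1 -> 0 <= a2 -> Z z1 -> Z z2 ->
    0 <= a1 * c z1 zh + a2 * c z2 zh.
  by move=> *; rewrite addr_ge0 ?mulr_ge0 // (site_ge0 kS).
have lt2 b (k1 k2 : 'I_K) a1 a2 z1 z2 : (k1 < k2)%N ->
    0 <= a1 -> 0 <= a2 -> a1 + a2 = 1 -> Z z1 -> Z z2 -> a1 * c z1 zh + a2 * c z2 zh <= b ->
    a1 * f k1 z1 + a2 * f k2 z2 <= v b.
  move=> k12 a10 a20 a12 Z1 Z2 hb.
  have b0 : 0 <= b by apply: le_trans hb; exact: bge0.
  have [s fs <-] := plan_feasible_ex a10 a20 a12 Z1 Z2 hb.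
  by have [_] := hv b b0; apply.
have neq2 b k1 k2 a1 a2 z1 z2 : k1 != k2 -> 0 <= a1 -> 0 <= a2 -> a1 + a2 = 1 ->
    Z z1 -> Z z2 -> a1 * c z1 zh + a2 * c z2 zh <= b ->
    a1 * f k1 z1 + a2 * f k2 z2 <= v b.
  move=> k12 a10 a20 a12 Z1 Z2 hb; case: (ltngtP k1 k2) => h.
  - exact: lt2.
  - by rewrite addrC; apply: lt2 => //; rewrite addrC.
  - by move: k12; rewrite -val_eqE /= h eqxx.
(* A single atom is a plan with weight 0 at [zh] on some other piece, which exists since K >= 2. *)
have one b k z : Z z -> c z zh <= b -> f k z <= v b.
  move=> Zz hb.
  have [k' kk'] : exists k', k != k'.
    have [k0|k0] := eqVneq (k : nat) 0%N.
      by exists (Ordinal K2); rewrite -val_eqE /= k0.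
    by exists (Ordinal (ltnW K2)); rewrite -val_eqE.
  have := neq2 b k k' 1 0 z zh kk' ler01 (lexx _) (addr0 _) Zz (site_in kS).
  by rewrite !mul0r !mul1r !addr0; apply.
(* Two atoms carrying the same piece [f k] are merged into their barycentre. *)
have all2 b k1 k2 a1 a2 z1 z2 : 0 <= a1 -> 0 <= a2 -> a1 + a2 = 1 ->
    Z z1 -> Z z2 -> a1 * c z1 zh + a2 * c z2 zh <= b ->
    a1 * f k1 z1 + a2 * f k2 z2 <= v b.
  move=> a10 a20 a12 Z1 Z2 hb; have [<-|k12] := eqVneq k1 k2; last exact: neq2.
  have a2E : a2 = 1 - a1 by lra.
  have t01 : 0 <= a1 <= 1 by lra.
  rewrite a2E in hb *.
  have [Zc kc] := site_convex kS t01 Z1 Z2.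
  apply: le_trans (loss_concave (fS k1) _ _ t01) _.
  by apply: one => //; exact: le_trans hb.
exists v; split.
- split.
  + move=> t x y /andP[t0 t1] x0 y0.
    have [[k1 [k2 [s [_ /plan_feasibleE[[s1 s2 s12] S1 S2 sb] sv]]]] _] := hv _ x0.
    have [[j1 [j2 [u [_ /plan_feasibleE[[u1 u2 u12] U1 U2 ub] uv]]]] _] := hv _ y0.
    rewrite -sv -uv /plan_value.
    (* Mixing the optimal plans for x and y gives four atoms, each recorded with its piece. One
       pivot cuts the first three to two, a second one absorbs the fourth. *)
    pose C (w : 'I_K * 'rV[R]_m) := c w.2 zh.
    pose L (w : 'I_K * 'rV[R]_m) := f w.1 w.2.
    pose P (w : 'I_K * 'rV[R]_m) := Z w.2.
    have t1' : 0 <= 1 - t by rewrite subr_ge0.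
    have [b1 [b2 [y1 [y2 [[b10 b20 b12] Y1 Y2 eC eL]]]]] :=
      @three_to_two R _ C L P _ _ _ (k1, zh + v1 s) (k2, zh + v2 s) (j1, zh + v1 u)
        (mulr_ge0 t0 s1) (mulr_ge0 t0 s2) (mulr_ge0 t1' u1) S1 S2 U1.
    have [d1 [d2 [w1 [w2 [[d10 d20 d12] W1 W2 eC' eL']]]]] :=
      @three_to_two R _ C L P _ _ _ y1 y2 (j2, zh + v2 u)
        b10 b20 (mulr_ge0 t1' u2) Y1 Y2 U2.
    have d1E : d1 + d2 = 1.
      rewrite d12 b12.
      transitivity (t * (alpha1 s + alpha2 s) + (1 - t) * (alpha1 u + alpha2 u)).
        by ring.
      by rewrite s12 u12; ring.
    have := all2 (t * x + (1 - t) * y) w1.1 w2.1 d1 d2 w1.2 w2.2 d10 d20 d1E W1 W2.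
    have h1 := ler_wpM2l t0 sb; have h2 := ler_wpM2l t1' ub.
    move: eC' eL' eC eL; rewrite /C /L /= => eC' eL' eC eL.
    have hC : d1 * c w1.2 zh + d2 * c w2.2 zh <= t * x + (1 - t) * y.
      by rewrite eC' eC; move: h1 h2; lra.
    by move=> /(_ hC); move: eL eL'; lra.
  + move=> x y x0 xy.
    have [[k1 [k2 [s [_ /plan_feasibleE[[s1 s2 s12] S1 S2 sb] <-]]]] _] := hv _ x0.
    by apply: all2 => //; exact: le_trans xy.
  + move=> e e0.
    have /choice[M hM] : forall k, exists M, 0 <= M /\
        forall z, Z z -> f k z <= f k zh + e + M * c z zh.
      by move=> k; have [M M0 h] := loss_growth_zh kS (loss_concave (fS k)) e0; exists M.
    (* The slopes are nonnegative, so their sum serves all pieces at once. *)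
    pose MM := \sum_k M k.
    have MMle k : M k <= MM.
      rewrite /MM (bigD1 k) //= lerDl sumr_ge0 // => j _; by have [] := hM j.
    have MM0 : 0 <= MM by rewrite sumr_ge0 // => j _; have [] := hM j.
    exists MM => // b b0.
    have le0 k z : Z z -> f k z <= v 0 + e + MM * c z zh.
      move=> Zz; have [_ /(_ z Zz)/le_trans] := hM k; apply.
      apply: lerD; last by rewrite ler_wpM2r // (site_ge0 kS).
      by rewrite lerD2r; apply: one; [exact: (site_in kS)|rewrite (site_zh kS)].
    have [[k1 [k2 [s [_ /plan_feasibleE[[s1 s2 s12] S1 S2 sb] <-]]]] _] := hv _ b0.
    have h1 := ler_wpM2l s1 (le0 k1 _ S1).
    have h2 := ler_wpM2l s2 (le0 k2 _ S2).
    have h3 := ler_wpM2l MM0 sb.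
    rewrite /plan_value.
    rewrite -[v 0 + e]mul1r -s12.
    move: h1 h2 h3; lra.
- move=> b b0; have [[k1 [k2 [s [k12 fs sv]]]] hu] := hv _ b0.
  apply/le_anti/andP; split.
    apply: bigmax_le => [|[j1 j2] /= j12]; first exact: leNye.
    by apply: ge_ereal_sup => _ [u fu <-]; rewrite lee_fin; exact: hu.
  apply: (@le_trans _ _ (V_pair Z c (f k1) (f k2) zh b)).
    by apply: ereal_sup_ubound; exists s => //; rewrite sv.
  exact: (@le_bigmax_cond _ _ _ _ (k1, k2) (fun k : 'I_K * 'I_K => (k.1 < k.2)%N)
    (fun k => V_pair Z c (f k.1) (f k.2) zh b)).
- by move=> b b0; have [] := hv _ b0.
- move=> z Zz; have [_ [k ->]] := max_loss_max f z (ltnW K2).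
  exact: one.
Qed.
End site_value.

(** * Distributing the budget *)

Section budget.
Context {R : realType} {N : nat} {v : 'I_N -> R -> R} {rho : R}.
Hypotheses (N0 : (0 < N)%N) (vV : forall i, value_function (v i)).

Lemma budget_setE (b : 'I_N -> R) : budget_set rho b <->
  (forall i, 0 <= b i) /\ \sum_i b i <= N%:R * rho.
Proof.
by rewrite /budget_set /= mulrC ler_pdivrMr ?ltr0n // mulrC.
Qed.

(** Each share lies in [0, N rho], so the budgets form a compact subset of R^N; clamping at 0 makes
    the objective continuous everywhere without changing it there. *)
Lemma budget_max : 0 <= rho -> exists2 b, budget_set rho b &
  forall b', budget_set rho b' -> \sum_i v i (b' i) <= \sum_i v i (b i).
Proof.
move=> rho0.
have sum_cont (g : 'I_N -> R -> R) : (forall i, continuous (g i)) ->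
    continuous (fun w : 'rV[R]_N => \sum_i g i (w ord0 i)).
  move=> gc; apply: (@continuous_big R^o 'I_N +%R 0 predT) => [|i _ w].
    by move=> w; exact: add_continuous.
  by apply: continuous_comp; [exact: coord_continuous|exact: gc].
pose T := N%:R * rho.
pose A := [set w : 'rV[R]_N | forall i, `[0, T]%classic (w ord0 i)].
pose D := [set w : 'rV[R]_N | \sum_i w ord0 i <= T].
have cA : compact (A `&` D).
  apply: compact_closedI.
    by apply: (@rV_compact _ _ (fun=> `[0, T]%classic)) => i; exact: segment_compact.
  have -> : D = (fun w : 'rV[R]_N => \sum_i w ord0 i) @^-1` [set x | x <= T] by [].
  apply: preimage_closed; last exact: closed_le.
  by move=> w _; apply: (sum_cont (fun _ => id)) => i x; exact: cvg_id.
have A0 : A `&` D !=set0.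
  exists 0; split => [i|]; rewrite /= ?mxE.
    by rewrite in_itv /= lexx /T mulr_ge0.
  by rewrite /D /= big1 => [|i _]; rewrite ?mxE // /T mulr_ge0.
have gc : continuous (fun w : 'rV[R]_N => \sum_i v i (Num.max 0 (w ord0 i))).
  apply: (sum_cont (fun i x => v i (Num.max 0 x))) => i.
  exact: value_function_continuous.
have [w] := EVT_max_rV A0 cA (continuous_subspaceT gc).
rewrite inE => -[wA wD] wM.
have w0 i : 0 <= w ord0 i by have := wA i; rewrite /= in_itv /= => /andP[].
exists (fun i => w ord0 i); first by apply/budget_setE; split.
move=> b /budget_setE[b0 bT].
have := wM (\row_i b i); rewrite inE.
have -> : \sum_i v i (Num.max 0 (w ord0 i)) = \sum_i v i (w ord0 i).
  by apply: eq_bigr => i _; rewrite max_r.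
have -> : \sum_i v i (Num.max 0 ((\row_i b i) ord0 i)) = \sum_i v i (b i).
  by apply: eq_bigr => i _; rewrite mxE max_r.
apply; split => [i|]; last by rewrite /D /=; under eq_bigr do rewrite mxE.
rewrite /= mxE in_itv /= b0 /=; apply: le_trans bT.
by rewrite (bigD1 i) //= lerDl sumr_ge0.
Qed.

Lemma budget_concave (t : R) (b b' : 'I_N -> R) : 0 <= t <= 1 ->
  (forall i, 0 <= b i) -> (forall i, 0 <= b' i) ->
  t * (\sum_i v i (b i)) + (1 - t) * (\sum_i v i (b' i)) <=
  \sum_i v i (t * b i + (1 - t) * b' i).
Proof.
move=> t01 b0 b'0; rewrite !mulr_sumr -big_split /=; apply: ler_sum => i _.
by have [gc _ _] := vV i; exact: gc.
Qed.

(* [lam] is a supergradient of the optimal value as a function of the total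
   budget: the slopes of chords to the right of [N rho] are bounded by the slopes
   of chords to its left, since the chord between two budgets on either side
   passes below the optimum. *)
Lemma budget_multiplier (M : R) : 0 < rho ->
  (forall b, budget_set rho b -> \sum_i v i (b i) <= M) ->
  exists2 lam, 0 <= lam & forall b, (forall i, 0 <= b i) ->
    \sum_i v i (b i) <= M + lam * (\sum_i b i - N%:R * rho).
Proof.
move=> rho0 hM; set T := N%:R * rho.
have T0 : 0 < T by rewrite mulr_gt0 // ltr0n.
pose S b := \sum_i v i (b i).
have slopes b b' : (forall i, 0 <= b i) -> (forall i, 0 <= b' i) ->
    T < \sum_i b i -> \sum_i b' i < T ->
    (S b - M) / (\sum_i b i - T) <= (M - S b') / (T - \sum_i b' i).
  move=> b0 b'0; set x := \sum_i b i; set y := \sum_i b' i => Tx yT.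
  (* The weight for which the mixture spends exactly [T]. *)
  pose t := (T - y) / (x - y).
  have xy : 0 < x - y by lra.
  have t01 : 0 <= t <= 1.
    apply/andP; split; last by rewrite ler_pdivrMr // mul1r; lra.
    by apply: divr_ge0; lra.
  have := budget_concave t01 b0 b'0.
  have hmix : budget_set rho (fun i => t * b i + (1 - t) * b' i).
    apply/budget_setE; split=> [i|].
      by move: t01 => /andP[t0 t1]; rewrite addr_ge0 // mulr_ge0 // subr_ge0.
    rewrite big_split /= -!mulr_sumr -/x -/y le_eqVlt; apply/orP; left; apply/eqP.
    by rewrite -/T /t; field; rewrite gt_eqF.
  move=> /le_trans/(_ (hM _ hmix)); rewrite -/(S b) -/(S b') => h.
  rewrite ler_pdivrMr ?subr_gt0 // mulrAC ler_pdivlMr ?subr_gt0 //.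
  have : (x - y) * (t * S b + (1 - t) * S b') <= (x - y) * M by rewrite ler_pM2l.
  have -> : (x - y) * (t * S b + (1 - t) * S b') = (T - y) * S b + (x - T) * S b'.
    by rewrite /t; field; rewrite gt_eqF.
  lra.
(* The slopes of chords to the right of [T]. Adding 0 makes the set nonempty and its supremum, the
   multiplier, nonnegative. *)
pose A := [set q | q = 0 \/ exists b, [/\ forall i, 0 <= b i, T < \sum_i b i &
  q = (S b - M) / (\sum_i b i - T)]].
have left_ub b' : (forall i, 0 <= b' i) -> \sum_i b' i < T ->
    ubound A ((M - S b') / (T - \sum_i b' i)).
  move=> b'0 b'T q [->|[b [b0 bT ->]]]; last exact: slopes.
  rewrite divr_ge0 ?subr_ge0 ?(ltW b'T) //; apply: hM; apply/budget_setE.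
  by split => //; exact: ltW.
have A0 : A !=set0 by exists 0; left.
have hA : has_sup A.
  split=> //; exists ((M - S (fun=> 0)) / (T - \sum_(i < N) 0)).
  by apply: left_ub => //; rewrite big1.
exists (sup A); first by apply: ub_le_sup; [exact: hA.2|left].
move=> b b0; rewrite -/(S b) addrC -lerBlDr.
have [bT|bT|bT] := ltgtP (\sum_i b i) T.
- have : sup A <= (M - S b) / (T - \sum_i b i) by apply: ge_sup => //; exact: left_ub.
  by rewrite ler_pdivlMr ?subr_gt0 //; lra.
- rewrite -ler_pdivrMr ?subr_gt0 //; apply: ub_le_sup; first exact: hA.2.
  by right; exists b.
- by rewrite bT subrr mulr0 subr_le0; apply: hM; apply/budget_setE; rewrite bT.
Qed.
End budget.

(** * Integration *)

Section integral_nomeas.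
Import HBNNSimple.

(* The measurability hypotheses of [ge0_le_integral] disappear because the integral
   of a nonnegative function is a supremum over the simple functions below it. *)
Lemma ge0_le_integral_nomeas (R : realType) (d : measure_display)
    (T : measurableType d) (mu : {measure set T -> \bar R}) (D : set T)
    (f1 f2 : T -> \bar R) :
  (forall x, D x -> (0 <= f1 x)%E) -> (forall x, D x -> (f1 x <= f2 x)%E) ->
  (\int[mu]_(x in D) f1 x <= \int[mu]_(x in D) f2 x)%E.
Proof.
move=> f0 f12.
rewrite ge0_integralE // ge0_integralE; last first.
  by move=> x Dx; exact: le_trans (f0 x Dx) (f12 x Dx).
apply: le_ereal_sup => _ [h hf <-]; exists h => // x.
apply: (le_trans (hf x)); exact: lee_restrict.
Qed.

End integral_nomeas.

(** Weights and points are sequences because [msum] adds up an initial segment of a sequence of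
    measures. *)
Definition atomic (R : realType) (d : measure_display) (T : measurableType d)
    (M : nat) (w : nat -> {nonneg R}) (pt : nat -> T) : {measure set T -> \bar R} :=
  msum (fun n => mscale (w n) (dirac (pt n))) M.

Section atomic.
Import HBNNSimple.
Context {R : realType} {d : measure_display} {T : measurableType d}.
Variables (M : nat) (w : nat -> {nonneg R}) (pt : nat -> T).

Lemma atomicE A : atomic M w pt A =
  (\sum_(n < M) (w n)%:num%:E * @dirac _ T (pt n) R A)%E.
Proof. by []. Qed.

Lemma ge0_integral_atomic (f : T -> R) : measurable_fun setT f ->
  (forall x, 0 <= f x) ->
  (\int[atomic M w pt]_x (f x)%:E = (\sum_(n < M) (w n)%:num * f (pt n))%:E)%E.
Proof.
move=> mf f0; rewrite /atomic ge0_integral_measure_sum //; last 2 first.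
- by move=> x _; rewrite lee_fin.
- exact/measurable_EFinP.
rewrite -sumEFin; apply: eq_bigr => n _.
rewrite ge0_integral_mscale //; last 2 first.
- exact/measurable_EFinP.
- by move=> x _; rewrite lee_fin.
rewrite integral_dirac //; last exact/measurable_EFinP.
by rewrite diracT mul1e EFinM.
Qed.

Lemma integral_atomic (f : T -> R) : measurable_fun setT f ->
  (\int[atomic M w pt]_x (f x)%:E = (\sum_(n < M) (w n)%:num * f (pt n))%:E)%E.
Proof.
move=> mf; rewrite integralE.
have -> : (fun x => (f x)%:E)^\+%E = (fun x => (f^\+ x)%:E).
  by apply/funext => x; rewrite funeposE /funrpos EFin_max.
have -> : (fun x => (f x)%:E)^\-%E = (fun x => (f^\- x)%:E).
  by apply/funext => x; rewrite funenegE /funrneg EFin_max.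
rewrite !ge0_integral_atomic //; last 2 first.
- exact: measurable_funrneg.
- exact: measurable_funrpos.
rewrite -EFinB -sumrB; congr (_%:E); apply: eq_bigr => n _.
rewrite -mulrBr /funrpos /funrneg; congr (_ * _).
by rewrite !maxEle; case: ifP; case: ifP; lra.
Qed.

(** A simple function below [f] on [D] is integrated exactly, and its value at each atom is at most
    that of [f]. The cost of a discrete coupling is bounded this way with no appeal to joint
    measurability of [c]. *)
Lemma integral_atomic_le (D : set T) (f : T -> R) :
  (forall x, D x -> 0 <= f x) -> (forall n, (n < M)%N -> D (pt n)) ->
  (\int[atomic M w pt]_(x in D) (f x)%:E <=
    (\sum_(n < M) (w n)%:num * f (pt n))%:E)%E.
Proof.
move=> f0 Dp; rewrite ge0_integralE //.
apply: ge_ereal_sup => _ [h hf <-].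
rewrite -integralT_nnsfun integral_atomic; last exact: measurable_funP.
rewrite lee_fin; apply: ler_sum => n _; apply: ler_wpM2l => //.
have := hf (pt n); rewrite patchE mem_set ?lee_fin //; exact: Dp.
Qed.

Lemma atomic_probability : \sum_(n < M) (w n)%:num = 1 ->
  exists P : probability T R, forall A, P A = atomic M w pt A.
Proof.
move=> w1.
have mu1 : atomic M w pt setT = 1%E.
  rewrite atomicE -[1%E]/(1%:E) -w1 -sumEFin; apply: eq_bigr => n _.
  by rewrite diracT mule1.
(* The mass is already 1: normalising changes nothing and supplies the structure of a
   probability. *)
exists (mnormalize (atomic M w pt) (dirac point)) => A.
by rewrite /= /mnormalize mu1 onee_eq0 /= invr1 mule1.
Qed.
End atomic.

(** Almost everywhere f^+ <= g^+ and g^- <= f^-, and nonnegative integrals are monotone. *)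
Lemma ae_le_integral (R : realType) (d : measure_display) (T : measurableType d)
    (mu : {measure set T -> \bar R}) (f g : T -> \bar R) :
  measurable_fun setT f -> measurable_fun setT g ->
  {ae mu, forall x, (f x <= g x)%E} ->
  (\int[mu]_x f x <= \int[mu]_x g x)%E.
Proof.
move=> mf mg fg; rewrite (integralE _ _ f) (integralE _ _ g).
have mono (h1 h2 : T -> \bar R) : measurable_fun setT h1 -> measurable_fun setT h2 ->
    (forall x, 0 <= h1 x)%E -> (forall x, 0 <= h2 x)%E ->
    (forall x, (f x <= g x)%E -> (h1 x <= h2 x)%E) ->
    (\int[mu]_x h1 x <= \int[mu]_x h2 x)%E.
  move=> m1 m2 h10 h20 h12; apply: ae_ge0_le_integral => //.
  by move: fg; apply: filterS => x xfg _; exact: h12.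
apply: leeB; apply: mono; rewrite ?funeposE ?funenegE //.
- exact: measurable_funepos.
- exact: measurable_funepos.
- by move=> x xfg; rewrite !funeposE ge_max !le_max lexx xfg orbT.
- exact: measurable_funeneg.
- exact: measurable_funeneg.
- by move=> x xfg; rewrite !funenegE ge_max !le_max lexx leeN2 xfg orbT.
Qed.

Lemma integral_pushforward_meas (R : realType) (d1 d2 : measure_display)
    (X : measurableType d1) (Y : measurableType d2) (phi : X -> Y)
    (mu : {measure set X -> \bar R}) (nu : {measure set Y -> \bar R})
    (f : Y -> \bar R) :
  measurable_fun setT phi -> measurable_fun setT f ->
  (forall A, measurable A -> pushforward mu phi A = nu A) ->
  (\int[mu]_x f (phi x) = \int[nu]_y f y)%E.
Proof.
move=> mphi mf munu.
have key (g : Y -> \bar R) : measurable_fun setT g -> (forall y, 0 <= g y)%E ->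
    (\int[mu]_x g (phi x) = \int[nu]_y g y)%E.
  move=> mg g0; rewrite -(@ge0_integral_pushforward _ _ _ _ _ _ mphi mu setT g) //.
  pose pm : {measure set Y -> \bar R} := @pushforward _ _ _ _ _ mu phi.
  by apply: (@eq_measure_integral _ _ _ _ nu (pm mphi)) => A mA _; exact: munu.
rewrite (integralE _ _ f) (integralE _ _ (fun x => f (phi x))) -!key.
- by congr (_ - _)%E; apply: eq_integral => x _; rewrite ?funeposE ?funenegE.
- exact: measurable_funeneg.
- by [].
- exact: measurable_funepos.
- by [].
Qed.

(** Gives joint measurability of the transport cost from that of its sections: the second argument
    has finitely many relevant values, and the function is glued from the slices w.2 = y. *)
Lemma measurable_fun_snd_seq (R : realType) (d1 d2 : measure_display)
    (T1 : measurableType d1) (T2 : measurableType d2) (S : seq T2)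
    (f : T1 -> T2 -> R) :
  (forall y : T2, measurable [set y]) ->
  (forall y, y \in S -> measurable_fun setT (f ^~ y)) ->
  measurable_fun setT (fun w : T1 * T2 => if w.2 \in S then f w.1 w.2 else 0).
Proof.
move=> m1; elim: S => [|y S IH] mf.
  by rewrite (_ : (fun _ => _) = cst 0) //; exact: measurable_cst.
rewrite (_ : (fun _ => _) = (fun w : T1 * T2 => if w.2 == y then f w.1 y else
    if w.2 \in S then f w.1 w.2 else 0)); last first.
  by apply/funext => w; rewrite inE; case: eqVneq => [->|].
apply: measurable_fun_ifT.
- apply: (measurable_fun_bool true).
  rewrite setTI (_ : _ @^-1` _ = snd @^-1` [set y]).
    by rewrite -[X in measurable X]setTI; exact: measurable_snd.
  by apply/seteqP; split => w /= /eqP.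
- by apply: (measurableT_comp (f := f ^~ y)) => //; apply: mf; rewrite inE eqxx.
- by apply: IH => z zS; apply: mf; rewrite inE zS orbT.
Qed.

(** * Borel measurability on R^m *)

Section borel_rV.
Context {R : realType} {m : nat}.
Local Notation T := (borel_rV R m).

Lemma open_borel (A : set 'rV[R]_m) : open A -> measurable (A : set T).
Proof. by move=> oA; exact: sub_sigma_algebra. Qed.

Lemma closed_borel (A : set 'rV[R]_m) : closed A -> measurable (A : set T).
Proof.
move=> /closed_openC/open_borel; rewrite -[X in _ -> measurable X]setCK.
exact: measurableC.
Qed.

Lemma set1_borel (y : T) : measurable [set y].
Proof.
apply: closed_borel; apply: accessible_closed_set1.
by apply: hausdorff_accessible; exact: norm_hausdorff.
Qed.

Lemma measurable_fun_gt (f : T -> R) :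
  (forall a, measurable [set x | a < f x]) -> measurable_fun setT f.
Proof.
move=> mf; apply: (measurability _ (RGenOInfty.measurableE R)).
move=> /= _ [_ [a ->]] <-; rewrite setTI (_ : _ @^-1` _ = [set x | a < f x]) //.
by apply/seteqP; split => x /=; rewrite in_itv /= andbT.
Qed.

Lemma continuous_borel (f : 'rV[R]_m -> R) : continuous f ->
  measurable_fun setT (f : T -> R).
Proof.
move=> /continuousP cf; apply: measurable_fun_gt => a.
by apply: open_borel; apply: (cf [set x | a < x]); exact: open_gt.
Qed.

Lemma site_cost_borel (Z : set 'rV[R]_m) zh k : site_cost Z zh k ->
  measurable_fun setT ((fun z => if z \in Z then k z else 0) : T -> R).
Proof.
move=> kS; apply: measurable_fun_gt => a.
have mZ : measurable (Z : set T) by apply: closed_borel; exact: site_closed kS.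
have [a0|a0] := leP 0 a.
  rewrite (_ : [set _ | _] = Z `\` [set z | Z z /\ k z <= a]).
    by apply: measurableD => //; apply: closed_borel; exact: site_sublevel_closed kS _.
  apply/seteqP; split => z /=.
    case: ifPn => [|_]; last by rewrite ltNge a0.
    by rewrite inE => Zz az; split=> // -[_]; rewrite leNgt az.
  move=> [Zz h]; rewrite mem_set // ltNge; apply/negP => ka; exact: h.
rewrite (_ : [set _ | _] = setT) //.
apply/seteqP; split => z //= _; case: ifPn => //; rewrite inE => Zz.
by apply: lt_le_trans a0 _; exact: (site_ge0 kS).
Qed.
End borel_rV.

(** * Transport from the empirical distribution *)

Section transport.
Context {R : realType} {m N : nat} {Z : set 'rV[R]_m}
  {c : 'rV[R]_m -> 'rV[R]_m -> R} {zh : 'I_N -> 'rV[R]_m}.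
Local Notation T := (borel_rV R m).
Hypotheses (N0 : (0 < N)%N) (cS : forall i, site_cost Z (zh i) (c ^~ (zh i)))
  (c0 : forall z y, Z z -> Z y -> 0 <= c z y).

Lemma integral_empirical (nu : {measure set T -> \bar R}) (f : T -> R) :
  measurable_fun setT f -> (forall A, measurable A -> nu A = empirical zh A) ->
  (\int[nu]_y (f y)%:E = (N%:R^-1 * \sum_i f (zh i))%:E)%E.
Proof.
case: N N0 zh => // N' _ zh' mf nuE.
have n0 : 0 <= (N'.+1%:R : R)^-1 by rewrite invr_ge0.
pose w (n : nat) : {nonneg R} := NngNum n0.
pose pt (n : nat) : T := zh' (inord n).
rewrite (@eq_measure_integral _ _ _ _ (atomic N'.+1 w pt)); last first.
  move=> A mA _; rewrite nuE // atomicE /empirical ge0_sume_distrr; last first.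
    by move=> i _; rewrite lee_fin.
  by apply: eq_bigr => i _; rewrite /pt inord_val.
rewrite integral_atomic // mulr_sumr; congr (_%:E).
by apply: eq_bigr => i _; rewrite /pt inord_val.
Qed.

(** The pointwise bound is integrated against [gamma]: the first marginal yields the expectation of
    [L] under [Q], the second the mean of [sig] over the zh_i, and the cost term is at most lam
    B. *)
Lemma coupling_bound (Q : probability T R) (gamma : probability (T * T)%type R)
    (L sig : T -> R) (lam B : R) :
  is_coupling Q (empirical zh) gamma -> Q Z = 1%E ->
  measurable_fun setT L -> 0 <= lam ->
  (forall z i, Z z -> L z <= sig (zh i) + lam * c z (zh i)) ->
  (\int[gamma]_(w in Z `*` Z) (c w.1 w.2)%:E <= B%:E)%E ->
  (\int[Q]_z (L z)%:E <= (N%:R^-1 * (\sum_i sig (zh i)) + lam * B)%:E)%E.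
Proof.
move=> [g1 g2] QZ mL lam0 bnd gB.
pose S : seq T := codom zh.
have SZ y : y \in S -> Z y by move=> /codomP[i ->]; exact: site_in (cS i).
have mZ : measurable (Z : set T).
  by apply: closed_borel; exact: site_closed (cS (Ordinal N0)).
have mS : measurable [set y : T | y \in S].
  elim: {SZ} S => [|y S IH]; first by
    rewrite (_ : [set _ | _] = set0) //; apply/seteqP; split => y.
  rewrite (_ : [set _ | _] = [set y] `|` [set z | z \in S]).
    by apply: measurableU => //; exact: set1_borel.
  apply/seteqP; split => z /=; rewrite inE.
    by move=> /orP[/eqP|]; [left|right].
  by move=> [->|->]; rewrite ?eqxx ?orbT.
(* Measurable stand-ins for [c] and [sig], cut off to 0 away from [Z] and from the finite support
   [S]; they are exact on Z x S, which has full [gamma] measure. *)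
pose ct (w : T * T) : R :=
  if w.2 \in S then (if w.1 \in Z then c w.1 w.2 else 0) else 0.
pose st (y : T) : R := if y \in S then sig y else 0.
have ct0 w : 0 <= ct w.
  rewrite /ct; case: ifPn => // /SZ Zy; case: ifPn => //; rewrite inE => Zz.
  exact: c0.
have mct : measurable_fun setT ct.
  apply: (@measurable_fun_snd_seq R _ _ T T S (fun z y => if z \in Z then c z y else 0)).
    exact: set1_borel.
  by move=> y /codomP[i ->]; exact: (site_cost_borel (cS i)).
have mst2 : measurable_fun setT (fun w : T * T => st w.2).
  apply: (@measurable_fun_snd_seq R _ _ T T S (fun _ y => sig y)).
    exact: set1_borel.
  by move=> y _; exact: measurable_cst.
have mst : measurable_fun setT st.
  exact: (measurable_fun_pair2 point mst2).
(* Used with the identity for the value and with the absolute value for integrability. *)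
have Ist (f : R -> R) : measurable_fun setT f ->
    (\int[gamma]_w (f (st w.2))%:E = (N%:R^-1 * \sum_i f (sig (zh i)))%:E)%E.
  move=> mf.
  pose pm : {measure set T -> \bar R} := @pushforward _ _ _ _ _ gamma snd.
  have mfst : measurable_fun setT (f \o st) by exact: measurableT_comp.
  rewrite (@integral_pushforward_meas _ _ _ _ _ snd gamma (pm measurable_snd)
    (EFin \o (f \o st))) //; last exact/measurable_EFinP.
  rewrite (integral_empirical mfst) //.
  congr (_ * _)%:E; apply: eq_bigr => i _.
  by rewrite /= /st codom_f.
have Ict : (\int[gamma]_w (ct w)%:E <= B%:E)%E.
  apply: le_trans gB.
  have -> : (\int[gamma]_w (ct w)%:E = \int[gamma]_(w in Z `*` Z) (ct w)%:E)%E.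
    rewrite [RHS]integral_mkcond; apply: eq_integral => w _; rewrite patchE.
    case: ifPn => //; rewrite /ct => /negP h; case: ifPn => // w2; case: ifPn => // w1.
    by exfalso; apply: h; rewrite inE; split; [rewrite inE in w1|exact: SZ].
  apply: ge0_le_integral_nomeas => -[z y] /= [Zz Zy]; rewrite lee_fin //.
  by rewrite /ct /=; case: ifPn => // _; [rewrite mem_set|exact: c0].
have ist : gamma.-integrable setT (fun w => (st w.2)%:E).
  apply/integrableP; split; first exact/measurable_EFinP.
  by under eq_integral do rewrite abse_EFin; rewrite (Ist Num.norm) ?ltry.
have ict : gamma.-integrable setT (fun w => (ct w)%:E).
  apply/integrableP; split; first exact/measurable_EFinP.
  under eq_integral do rewrite abse_EFin ger0_norm //.
  exact: le_lt_trans Ict (ltry _).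
have ilct : gamma.-integrable setT (fun w => (lam%:E * (ct w)%:E)%E).
  exact: integrableZl.
have mEL : measurable_fun setT (EFin \o L) by exact/measurable_EFinP.
rewrite -(integral_pushforward_meas measurable_fst mEL g1).
apply: (@le_trans _ _ (\int[gamma]_w ((st w.2)%:E + lam%:E * (ct w)%:E))%E).
  apply: ae_le_integral.
  - by apply/measurable_EFinP; exact: measurableT_comp.
  - by apply: emeasurable_funD; [exact/measurable_EFinP|exact: (measurable_int gamma)].
  (* The bound can fail only where z is outside [Z] or y outside [S]; these sets are null by the
     first and the second marginal. *)
  have nZ : gamma.-negligible (fst @^-1` (~` Z) : set (T * T)).
    apply/negligibleP.
      by rewrite -[X in measurable X]setTI; apply: measurable_fst => //;
        exact: measurableC.
    apply: (etrans (g1 _ (measurableC mZ))).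
    by rewrite probability_setC // QZ subee.
  have nS : gamma.-negligible (snd @^-1` (~` [set y : T | y \in S]) : set (T * T)).
    apply/negligibleP.
      by rewrite -[X in measurable X]setTI; apply: measurable_snd => //;
        exact: measurableC.
    apply: (etrans (g2 _ (measurableC mS))).
    rewrite /empirical big1 ?mule0 // => i _.
    by rewrite diracE memNset //= => /(_ (codom_f zh i)).
  have := negligibleU nZ nS; apply: negligibleS => -[z y] /= H.
  apply: contrapT => /not_orP[/contrapT Zz /contrapT yS]; apply: H.
  rewrite -EFinM -EFinD lee_fin /st /ct /= yS mem_set //.
  by have /codomP[i ->] := yS; exact: bnd.
rewrite integralD // (Ist id) // integralZl // EFinD EFinM.
by rewrite leeD2l // EFinM lee_wpmul2l // lee_fin.
Qed.
End transport.

(** Serves twice: on R^m for the distribution of a plan, on pairs for the coupling that transports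
    it. *)
Lemma pair_atomic_probability (R : realType) (d : measure_display)
    (X : measurableType d) (N : nat) (a1 a2 : 'I_N -> R) (p1 p2 : 'I_N -> X) :
  (forall i, 0 <= a1 i) -> (forall i, 0 <= a2 i) -> \sum_i (a1 i + a2 i) = 1 ->
  exists P : probability X R,
  [/\ forall A, (P A = \sum_i ((a1 i)%:E * @dirac _ X (p1 i) R A +
        (a2 i)%:E * @dirac _ X (p2 i) R A))%E,
      forall f : X -> R, measurable_fun setT f ->
        (\int[P]_x (f x)%:E = (\sum_i (a1 i * f (p1 i) + a2 i * f (p2 i)))%:E)%E
    & forall (D : set X) (f : X -> R), (forall x, D x -> 0 <= f x) ->
        (forall i, D (p1 i)) -> (forall i, D (p2 i)) ->
        (\int[P]_(x in D) (f x)%:E <=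
          (\sum_i (a1 i * f (p1 i) + a2 i * f (p2 i)))%:E)%E].
Proof.
case: N a1 a2 p1 p2 => [|N] a1 a2 p1 p2 a10 a20.
  by rewrite big_ord0 => /eqP; rewrite eq_sym oner_eq0.
move=> a1E.
pose w n : {nonneg R} := if (n < N.+1)%N then NngNum (a10 (inord n))
  else NngNum (a20 (inord (n - N.+1))).
pose pt n := if (n < N.+1)%N then p1 (inord n) else p2 (inord (n - N.+1)).
have wl (i : 'I_N.+1) : (w i)%:num = a1 i by rewrite /w ltn_ord /= inord_val.
have wr (i : 'I_N.+1) : (w (N.+1 + i)%N)%:num = a2 i.
  by rewrite /w ltnNge leq_addr /= addKn inord_val.
have pl (i : 'I_N.+1) : pt i = p1 i by rewrite /pt ltn_ord inord_val.
have pr (i : 'I_N.+1) : pt (N.+1 + i)%N = p2 i.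
  by rewrite /pt ltnNge leq_addr /= addKn inord_val.
have w1 : \sum_(n < N.+1 + N.+1) (w n)%:num = 1.
  rewrite -a1E big_split_ord big_split /=.
  by congr (_ + _); apply: eq_bigr => i _; rewrite ?wl ?wr.
have sumE (f : X -> R) : \sum_(n < N.+1 + N.+1) (w n)%:num * f (pt n) =
    \sum_i (a1 i * f (p1 i) + a2 i * f (p2 i)).
  rewrite big_split_ord big_split /=.
  by congr (_ + _); apply: eq_bigr => i _; rewrite ?wl ?wr ?pl ?pr.
have [P PE] := atomic_probability pt w1.
have intE (D : set X) f : (\int[P]_(x in D) f x =
    \int[atomic (N.+1 + N.+1) w pt]_(x in D) f x)%E.
  by apply: eq_measure_integral => A _ _; exact: PE.
exists P; split.
- move=> A; rewrite PE atomicE big_split_ord big_split /=.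
  by congr (_ + _)%E; apply: eq_bigr => i _; rewrite ?wl ?wr ?pl ?pr.
- by move=> f mf; rewrite intE integral_atomic // sumE.
- move=> D f f0 D1 D2; rewrite intE -sumE; apply: integral_atomic_le => // n nM.
  by rewrite /pt; case: ifP.
Qed.

(** * Distributions encoded by plans and the duality bound *)

Section plan_probability.
Context {R : realType} {m N : nat} {Z : set 'rV[R]_m}
  {c : 'rV[R]_m -> 'rV[R]_m -> R} {zh : 'I_N -> 'rV[R]_m} {rho : R}.
Local Notation T := (borel_rV R m).
Hypotheses (N0 : (0 < N)%N) (cS : forall i, site_cost Z (zh i) (c ^~ (zh i)))
  (c0 : forall z y, Z z -> Z y -> 0 <= c z y).

(** The coupling pairs both atoms of the i-th plan with [zh i], keeping their weights; its marginals
    are the plan measure and the empirical distribution, and it costs at most the mean of the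
    b_i. *)
Lemma plan_probability (b : 'I_N -> R) (s : 'I_N -> plan R m) :
  budget_set rho b -> (forall i, plan_feasible Z c (zh i) (b i) (s i)) ->
  exists Q : probability T R,
  [/\ forall A, Q A = plan_measure zh s A, ambiguity_set Z c zh rho Q
    & forall f : T -> R, measurable_fun setT f ->
      (\int[Q]_z (f z)%:E =
        (N%:R^-1 * \sum_i plan_value f f (zh i) (s i))%:E)%E].
Proof.
move=> [b0 brho] fs; have fsE i := plan_feasibleE (fs i).
pose n : R := N%:R^-1.
have n0 : 0 <= n by rewrite /n invr_ge0.
pose a1 i := n * alpha1 (s i); pose a2 i := n * alpha2 (s i).
pose z1 i := zh i + v1 (s i); pose z2 i := zh i + v2 (s i).
have a10 i : 0 <= a1 i by have [[h _ _] _ _ _] := fsE i; rewrite mulr_ge0.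
have a20 i : 0 <= a2 i by have [[_ h _] _ _ _] := fsE i; rewrite mulr_ge0.
have a12 i : a1 i + a2 i = n.
  by have [[_ _ h] _ _ _] := fsE i; rewrite /a1 /a2 -mulrDr h mulr1.
have a1E : \sum_i (a1 i + a2 i) = 1.
  rewrite (eq_bigr (fun=> n)) // sumr_const card_ord -mulr_natr mulVf //.
  by rewrite pnatr_eq0 -lt0n.
have Z1 i : Z (z1 i) by have [_ ? _ _] := fsE i.
have Z2 i : Z (z2 i) by have [_ _ ? _] := fsE i.
have Zzh i : Z (zh i) by exact: site_in (cS i).
have [Q [QE Qint _]] := @pair_atomic_probability R _ T N a1 a2 z1 z2 a10 a20 a1E.
have [G [GE _ Gint]] := @pair_atomic_probability R _ (T * T)%type N a1 a2
  (fun i => (z1 i, zh i)) (fun i => (z2 i, zh i)) a10 a20 a1E.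
have dge0 d (X : measurableType d) (x : X) A : (0 <= @dirac _ X x R A)%E.
  by rewrite lee_fin.
exists Q; split.
- move=> A; rewrite QE /plan_measure ge0_sume_distrr => [|i _]; last first.
    have [[h1 h2 _] _ _ _] := fsE i.
    by rewrite adde_ge0 // mule_ge0 // lee_fin.
  apply: eq_bigr => i _; have [[h1 h2 _] _ _ _] := fsE i.
  rewrite ge0_muleDr; [|by rewrite mule_ge0 // lee_fin..].
  by rewrite !muleA -!EFinM.
- split.
    rewrite QE -[1%E]/(1%:E) -a1E -sumEFin; apply: eq_bigr => i _.
    by rewrite !diracE !mem_set //= !mule1 EFinD.
  apply: (@le_trans _ _ (\int[G]_(w in Z `*` Z) (c w.1 w.2)%:E)%E).
    apply: ereal_inf_lbound; exists G => //; split => A mA.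
      by rewrite /pushforward GE QE.
    rewrite /pushforward GE /empirical ge0_sume_distrr //.
    apply: eq_bigr => i _; rewrite -ge0_muleDl ?lee_fin //.
    by rewrite -EFinD a12.
  apply: le_trans (Gint _ (fun w => c w.1 w.2) _ _ _) _ => //=.
  + by move=> [z y] /= [Zz Zy]; exact: c0.
  rewrite lee_fin; apply: le_trans brho; rewrite -/n mulr_sumr.
  apply: ler_sum => i _; have [_ _ _ h] := fsE i.
  by rewrite /a1 /a2 -!mulrA -mulrDr ler_wpM2l.
- move=> f mf; rewrite Qint // -/n mulr_sumr; congr (_%:E).
  by apply: eq_bigr => i _; rewrite /plan_value /a1 /a2 mulrDr !mulrA.
Qed.

(** Lagrangian duality: the multiplier at b_i = c(z_i, zh_i) bounds the sum of L(z_i) - lam c(z_i,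
    zh_i) for all choices of the z_i at once, and suprema over each z_i give the dual function
    [sig]. *)
Lemma worst_case_bound (L : T -> R) (v : 'I_N -> R -> R) (M : R)
    (Q : probability T R) :
  0 < rho -> measurable_fun setT L -> (forall i, value_function (v i)) ->
  (forall i z, Z z -> L z <= v i (c z (zh i))) ->
  (forall b, budget_set rho b -> \sum_i v i (b i) <= M) ->
  ambiguity_set Z c zh rho Q ->
  (\int[Q]_z (L z)%:E <= (N%:R^-1 * M)%:E)%E.
Proof.
move=> rho0 mL vV Lv hM [QZ OTQ].
have [lam lam0 hlam] := budget_multiplier N0 vV rho0 hM.
set B := N%:R * rho in hlam.
have Zzh i : Z (zh i) by exact: site_in (cS i).
have key (zs : 'I_N -> T) : (forall i, Z (zs i)) ->
    \sum_i (L (zs i) - lam * c (zs i) (zh i)) <= M - lam * B.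
  move=> Zs; rewrite sumrB -mulr_sumr.
  have := hlam (fun i => c (zs i) (zh i)) (fun i => c0 (Zs i) (Zzh i)).
  have : \sum_i L (zs i) <= \sum_i v i (c (zs i) (zh i)).
    by apply: ler_sum => i _; exact: Lv.
  lra.
(* Indexed by the point y rather than by i, since [sig] is to be integrated; equal atoms share one
   value. *)
pose S (y : T) := [set L z - lam * c z y | z in Z].
have supS i : has_sup (S (zh i)).
  split; first by exists (L (zh i) - lam * c (zh i) (zh i)), (zh i).
  (* Only the i-th point moves; the others stay at their atoms. *)
  exists (M - lam * B - \sum_(j | j != i) (L (zh j) - lam * c (zh j) (zh j))).
  move=> _ [z Zz <-].
  have Zs j : Z (if j == i then z else zh j) by case: ifP.
  have := key _ Zs; rewrite (bigD1 i) //= eqxx.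
  rewrite [X in _ + X <= _](eq_bigr (fun j => L (zh j) - lam * c (zh j) (zh j))).
    lra.
  by move=> j /negbTE ->.
pose sig y := sup (S y).
have sigP z i : Z z -> L z <= sig (zh i) + lam * c z (zh i).
  by move=> Zz; rewrite -lerBlDr; apply: ub_le_sup; [exact: (supS i).2|exists z].
have sigle : \sum_i sig (zh i) <= M - lam * B.
  apply/ler_addgt0Pr => e e0.
  have e1 : 0 < e / N%:R by rewrite divr_gt0 // ltr0n.
  have /choice[zs hzs] : forall i, exists z, Z z /\
      sig (zh i) - e / N%:R < L z - lam * c z (zh i).
    by move=> i; have [_ [z Zz <-] h] := sup_adherent e1 (supS i); exists z.
  have : \sum_i (sig (zh i) - e / N%:R) <= M - lam * B.
    apply: le_trans (key zs (fun i => (hzs i).1)).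
    by apply: ler_sum => i _; exact: ltW (hzs i).2.
  rewrite sumrB sumr_const card_ord -[_ *+ N]mulr_natr divfK; last first.
    by rewrite pnatr_eq0 -lt0n.
  lra.
apply/lee_addgt0Pr => e e0.
(* [OT] is an infimum, so some coupling costs at most rho + e / (lam + 1), and the multiplier turns
   the excess into at most e. *)
have e1 : 0 < e / (lam + 1) by rewrite divr_gt0 // ltr_wpDl.
have : (OT Z c Q (empirical zh) < (rho + e / (lam + 1))%:E)%E.
  by apply: le_lt_trans OTQ _; rewrite lte_fin ltrDl.
move=> /ereal_inf_lt[_ [gamma gQ <-] /ltW gB].
apply: le_trans (coupling_bound N0 cS c0 gQ QZ mL lam0 sigP gB) _.
rewrite -EFinD lee_fin.
have n0 : 0 < (N%:R : R)^-1 by rewrite invr_gt0 ltr0n.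
have := ler_wpM2l (ltW n0) sigle.
have -> : N%:R^-1 * (M - lam * B) = N%:R^-1 * M - lam * rho.
  by rewrite /B; field; rewrite pnatr_eq0 -lt0n.
have : lam * (e / (lam + 1)) <= e.
  by rewrite mulrCA ger_pMr // ler_pdivrMr ?ltr_wpDl // mul1r lerDl.
lra.
Qed.
End plan_probability.

(** * The worst-case expectation *)

(** Lower semicontinuity on Z x Z restricts to the slice through [zh]; the growth clause combines
    norm equivalence with the lower bound nrm ^ p on the cost. *)
Lemma transport_site_cost (R : realType) (m : nat) (Z : set 'rV[R]_m)
    (c : 'rV[R]_m -> 'rV[R]_m -> R) (nrm : 'rV[R]_m -> R) (p : R) (zh : 'rV[R]_m) :
  transport_cost Z c -> closed Z -> convex_set Z -> is_norm nrm -> 1 <= p ->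
  (forall z z', Z z -> Z z' -> nrm (z - z') `^ p <= c z z') -> Z zh ->
  site_cost Z zh (c ^~ zh).
Proof.
move=> [c0 clsc czz ccvx] Zc Zcvx nrmN p1 growth Zzh; split => //.
- move=> t x y t01 Zx Zy; split; first exact: convex_setP.
  exact: (convex_functionP (ccvx zh Zzh)).
- by move=> z Zz; exact: c0.
- exact: czz.
- move=> z a Zz az.
  have Zzz : (Z `*` Z) (z, zh) by split.
  have [V nV hV] := clsc (z, zh) a az.
  have [W nW WE] := (@nbhs_subspace_ex ('rV[R]_m * 'rV[R]_m)%type (Z `*` Z) V _ Zzz).1 nV.
  have [[W1 W2] /= [nW1 nW2] W12] := nW.
  apply: filterS nW1 => y W1y Zy.
  have : (W `&` Z `*` Z) (y, zh).
    split; last by split.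
    by apply: W12; split => //=; exact: nbhs_singleton nW2.
  by rewrite -WE => -[/hV].
- move=> e e0; have [k k0 hk] := norm_equiv nrmN.
  have [M M0 hM] := linear_le_powR p1 (divr_gt0 e0 k0).
  exists (k * M) => [|z Zz]; first by rewrite mulr_ge0 // ltW.
  have nge : 0 <= nrm (z - zh).
    by rewrite -(pmulr_rge0 _ k0); apply: le_trans (hk _).
  apply: (le_trans (hk _)).
  have -> : e + k * M * c z zh = k * (e / k + M * c z zh).
    by field; rewrite gt_eqF.
  rewrite ler_pM2l //; apply: (le_trans (hM _ nge)).
  by rewrite lerD2l ler_wpM2l // growth.
Qed.

(* For [p > 1] a concave loss grows at most linearly while the cost grows like
   the [p]-th power; for [p = 1] the assumed growth exponent [r < 1] is used. *)
Lemma growth_site_loss (R : realType) (m : nat) (Z : set 'rV[R]_m)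
    (c : 'rV[R]_m -> 'rV[R]_m -> R) (nrm : 'rV[R]_m -> R) (p : R)
    (zh : 'rV[R]_m) (f : 'rV[R]_m -> R) :
  is_norm nrm -> 1 <= p ->
  (forall z z', Z z -> Z z' -> nrm (z - z') `^ p <= c z z') ->
  Z zh -> concave f ->
  (p = 1 -> exists (g : R) (z0 : 'rV[R]_m) (r : R), [/\ 0 < g, 0 <= r < 1 &
    forall z, Z z -> f z <= g * (1 + nrm (z - z0) `^ r)]) ->
  site_loss Z (c ^~ zh) f.
Proof.
move=> nrmN p1 growth Zzh cf hg; split=> // e e0.
have [k k0 hk] := norm_equiv nrmN.
have nge v : 0 <= nrm v by rewrite -(pmulr_rge0 _ k0); apply: le_trans (hk _).
have [pE|pn1] := eqVneq p 1.
  have [g [z0 [r [g0 r01 hf]]]] := hg pE.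
  have [C hC] := powR_sublinear r01 (divr_gt0 e0 g0).
  exists (g * (1 + C) + e * nrm (zh - z0)) => z Zz.
  apply: (le_trans (hf z Zz)).
  have h1 : g * nrm (z - z0) `^ r <= g * C + e * nrm (z - z0).
    have -> : g * C + e * nrm (z - z0) = g * (C + e / g * nrm (z - z0)).
      by field; rewrite gt_eqF.
    by rewrite ler_pM2l // hC.
  (* The triangle inequality moves the reference point from [z0] to [zh], and for p = 1 the cost
     dominates the distance to [zh]. *)
  have h2 : nrm (z - z0) <= c z zh + nrm (zh - z0).
    have [tri _ _] := nrmN; rewrite -(subrKA zh); apply: le_trans (tri _ _) _.
    rewrite lerD2r; apply: le_trans (growth _ _ Zz Zzh).
    by rewrite pE powRr1.
  have h3 := ler_wpM2l (ltW e0) h2.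
  move: h1 h3; lra.
have p1' : 1 < p by rewrite lt_def pn1.
have p0 : 0 < p by exact: lt_trans p1'.
have [A A0 [hA _]] := concave_upper_linear zh cf.
pose D := A * k + 1.
have D0 : 0 < D by rewrite ltr_wpDl // mulr_ge0 // ltW.
have r01 : 0 <= p^-1 < 1 by rewrite invr_ge0 (ltW p0) /= invf_lt1.
have [C hC] := powR_sublinear r01 (divr_gt0 e0 D0).
exists (f zh + D * C) => z Zz.
have := hA (z - zh); rewrite [zh + _]addrC subrK => h1.
have h2 : A * `|z - zh| <= D * nrm (z - zh).
  apply: (@le_trans _ _ (A * (k * nrm (z - zh)))); first by rewrite ler_wpM2l.
  by rewrite mulrA ler_wpM2r // lerDl.
have h3 : D * nrm (z - zh) <= D * C + e * c z zh.
  have -> : D * C + e * c z zh = D * (C + e / D * c z zh).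
    by field; rewrite gt_eqF.
  rewrite ler_pM2l //.
  (* The distance is the power 1 / p < 1 of a quantity bounded by the cost. *)
  have {1}-> : nrm (z - zh) = (nrm (z - zh) `^ p) `^ p^-1.
    by rewrite -powRrM mulfV ?powRr1 // gt_eqF.
  apply: (le_trans (hC _ (powR_ge0 _ _))).
  by rewrite lerD2l ler_pM2l ?divr_gt0 // growth.
lra.
Qed.

Lemma max_loss_borel (R : realType) (m K : nat) (f : 'I_K -> 'rV[R]_m -> R) :
  (0 < K)%N -> (forall k, continuous (f k)) ->
  measurable_fun [set: borel_rV R m] (max_loss f).
Proof.
move=> K0 fc; apply: measurable_fun_gt => a.
rewrite (_ : [set _ | _] = \bigcup_(k in setT) [set z | a < f k z]).
  apply: open_borel; apply: bigcup_open => k _.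
  by have /continuousP fkc := fc k; apply: (fkc [set y | a < y]); exact: open_gt.
apply/seteqP; split => z /=; have [hle [k hk]] := max_loss_max f z K0.
  by rewrite hk => ak; exists k.
by move=> [j _ /= aj]; exact: lt_le_trans aj (hle j).
Qed.

Theorem theorem1 (R : realType) (n m N K : nat)
  (X : set 'rV[R]_n) (Z : set 'rV[R]_m)
  (c : 'rV[R]_m -> 'rV[R]_m -> R)
  (zh : 'I_N -> 'rV[R]_m) (rho : R)
  (l : 'I_K -> 'rV[R]_n -> 'rV[R]_m -> R)
  (nrm : 'rV[R]_m -> R) (p : R)
  (hN : (0 < N)%N) (hzh : forall i, Z (zh i)) (hrho : 0 < rho)
  (hc : transport_cost Z c)
  (hX0 : X !=set0) (hXconv : convex_set X)
  (hQ0 : exists2 Q0 : probability (borel_rV R m) R,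
     ambiguity_set Z c zh rho Q0 &
     (forall a : R, compact
        [set x | X x /\ ('E_Q0[max_loss (fun k => l k x)] <= a%:E)%E]) /\
     (exists2 x0, X x0 & (-oo < 'E_Q0[max_loss (fun k => l k x0)])%E))
  (hZ0 : Z !=set0) (hZclosed : closed Z) (hZconv : convex_set Z)
  (hK : (2 <= K)%N)
  (hlconvex : forall k z, convex_function setT (fun x => l k x z))
  (hlconcave : forall k x, convex_function setT (fun z => - l k x z))
  (hnrm : is_norm nrm) (hp : 1 <= p)
  (hcgrowth : forall z z', Z z -> Z z' -> nrm (z - z') `^ p <= c z z')
  (hlgrowth : p = 1 -> forall x, X x ->
     exists (g : R) (z0 : 'rV[R]_m) (r : R),
       [/\ 0 < g, Z z0, 0 <= r < 1
         & forall z, Z z ->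
             max_loss (fun k => l k x) z <= g * (1 + nrm (z - z0) `^ r)])
  (x : 'rV[R]_n) (hx : X x) :
  let lx := fun k => l k x in
  let P := ambiguity_set Z c zh rho in
  let E := fun Q : probability (borel_rV R m) R => ('E_Q[max_loss lx])%E in
  let B := budget_set (N := N) rho in
  let F := budget_value Z c lx zh in
  [/\ (* the maxima defining the V_i^(k1,k2) are attained *)
      forall (i : 'I_N) (k1 k2 : 'I_K) (b : R), (k1 < k2)%N -> 0 <= b ->
        exists s, is_maximizer
          (fun s => (plan_value (lx k1) (lx k2) (zh i) s)%:E)
          (plan_feasible Z c (zh i) b) s,
      (* both maxima are attained and have the same value *)
      exists Q b, [/\ is_maximizer E P Q, is_maximizer F B b & E Q = F b]
      (* optimal solutions of the finite problem encode worst-case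
         distributions *)
    & forall b (k1 k2 : 'I_N -> 'I_K) (s : 'I_N -> plan R m),
        is_maximizer F B b ->
        (forall i, [/\ (k1 i < k2 i)%N, plan_feasible Z c (zh i) (b i) (s i)
           & (plan_value (lx (k1 i)) (lx (k2 i)) (zh i) (s i))%:E =
             V_max Z c lx (zh i) (b i)]) ->
        exists Q, is_maximizer E P Q /\
          forall A, measurable A -> Q A = plan_measure zh s A].
Proof.
move=> lx P E B F.
have K0 : (0 < K)%N by exact: ltnW.
have lc k : concave (lx k) by exact: convex_function_concave (hlconcave k x).
have cS i : site_cost Z (zh i) (c ^~ (zh i)).
  exact: (transport_site_cost hc hZclosed hZconv hnrm hp hcgrowth (hzh i)).
have lS i k : site_loss Z (c ^~ (zh i)) (lx k).
  apply: (growth_site_loss hnrm hp hcgrowth (hzh i) (lc k)) => p1.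
  have [g [z0 [r [g0 _ r01 hg]]]] := hlgrowth p1 x hx.
  exists g, z0, r; split => // z Zz; apply: le_trans (hg z Zz).
  by have [+ _] := max_loss_max lx z K0; apply.
have c0 z y : Z z -> Z y -> 0 <= c z y by have [+ _ _ _] := hc; apply.
have mL : measurable_fun [set: borel_rV R m] (max_loss lx).
  by apply: max_loss_borel => // k; exact: concave_continuous.
have /choice[v hv] := fun i => site_value_function hK (cS i) (lS i).
have vV i : value_function (v i) by have [] := hv i.
have FE b : B b -> F b = (N%:R^-1 * \sum_i v i (b i))%:E.
  move=> [b0 _]; rewrite /F /budget_value EFinM -sumEFin.
  by congr (_ * _)%E; apply: eq_bigr => i _; have [_ + _ _] := hv i; apply.
have EE Q : E Q = (\int[Q]_z (max_loss lx z)%:E)%E by rewrite /E unlock.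
have [b bB bM] := budget_max hN vV (ltW hrho).
have bmax : is_maximizer F B b.
  split=> // u uB; rewrite !FE // lee_fin ler_wpM2l ?invr_ge0 //; exact: bM.
have dual Q : P Q -> (E Q <= F b)%E.
  move=> PQ; rewrite EE FE //.
  apply: (worst_case_bound hN cS c0 hrho mL vV) => // i z Zz.
  by have [_ _ _ +] := hv i; apply.
(* Stated for every optimal budget, as the last claim requires. Each piece is below the maximum
   loss, so the plan measure has expectation at least F b' >= F b, and [dual] forces equality. *)
have primal b' (k1 k2 : 'I_N -> 'I_K) s : is_maximizer F B b' ->
    (forall i, plan_feasible Z c (zh i) (b' i) (s i) /\
      plan_value (lx (k1 i)) (lx (k2 i)) (zh i) (s i) = v i (b' i)) ->
    exists Q, [/\ is_maximizer E P Q, E Q = F b &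
      forall A, Q A = plan_measure zh s A].
  move=> [b'B b'M] fs.
  have [Q [QE PQ Qint]] := plan_probability hN cS c0 b'B (fun i => (fs i).1).
  have EF : E Q = F b.
    apply/le_anti/andP; split; first exact: dual.
    apply: (le_trans (b'M b bB)); rewrite EE Qint // FE // lee_fin.
    rewrite ler_wpM2l ?invr_ge0 //; apply: ler_sum => i _.
    have [/plan_feasibleE[[h1 h2 _] _ _ _] <-] := fs i.
    by apply: lerD; apply: ler_wpM2l => //; exact: (max_loss_max lx _ K0).1.
  by exists Q; split => //; split => // Q' PQ'; rewrite EF; exact: dual.
split.
- by move=> i k1 k2 b' _ b'0; exact: (plan_maximizer (cS i) (lS i)).
- have /choice[s3 hs] : forall i, exists s : 'I_K * 'I_K * plan R m,
      plan_feasible Z c (zh i) (b i) s.2 /\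
      plan_value (lx s.1.1) (lx s.1.2) (zh i) s.2 = v i (b i).
    move=> i; have [_ _ + _] := hv i => /(_ (b i) (bB.1 i))[k1 [k2 [s [_ fs sv]]]].
    by exists (k1, k2, s).
  have [Q [Qmax EF _]] := primal b (fun i => (s3 i).1.1) (fun i => (s3 i).1.2)
    (fun i => (s3 i).2) bmax hs.
  by exists Q, b.
- move=> b' k1 k2 s b'max hs.
  have [Q [Qmax _ QE]] : exists Q, [/\ is_maximizer E P Q, E Q = F b &
      forall A, Q A = plan_measure zh s A].
    apply: (primal b' k1 k2) => // i; have [_ fs sv] := hs i; split => //.
    have [_ VE _ _] := hv i; apply: EFin_inj; rewrite sv VE //.
    by have [[b'0 _] _] := b'max.
  by exists Q; split => // A _; exact: QE.
Qed.
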